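(* Let $r\ge 2$ and $d\ge 3$ be fixed integers, and let $G\in\mathcal{G}_{n,d}$ be a random $d$-regular graph. Then with high probability $\mathcal{D}_r(G,\mathcal{T}_n)=\Theta(n)$; that is, there are constants $c_1,c_2>0$ depending only on $r$ and $d$ such that with probability tending to $1$ as $n\to\infty$ one has $c_1 n\le \mathcal{D}_r(G,\mathcal{T}_n)\le c_2 n$.
   Context: $\mathcal{G}_{n,d}$ denotes the uniform distribution over the set of all (simple, labelled) $d$-regular graphs on $n$ vertices, with $dn$ even. ''With high probability'' means with probability tending to $1$ as $n\to\infty$ (over $n$ with $dn$ even). (Such $G$ is connected with high probability, so the quantity below is defined with high probability.) Spanning-tree discrepancy: for a connected $n$-vertex graph $G$, an $r$-colouring $f:E(G)\to[r]$ of its edges, and a spanning tree $T$ of $G$ (which has $n-1$ edges), put $D_f(T) := r\cdot\left(\max_{1\le i\le r}|f^{-1}(i)\cap E(T)| - \frac{n-1}{r}\right)$. The $r$-colour spanning-tree discrepancy of $G$ is $\mathcal{D}_r(G,\mathcal{T}_n) := \min_{f:E(G)\to[r]}\ \max_{T} D_f(T)$, where the maximum is over all spanning trees $T$ of $G$. *)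

(* Defs.v *)
From HB Require Import structures.
From mathcomp Require Import all_boot all_order all_algebra.
From mathcomp Require Import all_classical all_reals all_analysis.
Set Implicit Arguments.
Unset Strict Implicit.
Unset Printing Implicit Defensive.
Import Order.TTheory GRing.Theory Num.Theory.
Import numFieldNormedType.Exports.
Local Open Scope ring_scope.

(* A simple graph on the vertex set V is given by its edge set, a set of
   unordered pairs; [simple_graph] rules out members that are not pairs. *)
Definition simple_graph (V : finType) (E : {set {set V}}) : bool :=
  [forall e in E, #|e| == 2%N].

Definition adj_rel (V : finType) (E : {set {set V}}) : rel V :=
  fun u v => [set u; v]%SET \in E.

Definition degree (V : finType) (E : {set {set V}}) (v : V) : nat :=
  #|[set u | adj_rel E v u]%SET|.

Definition regular_graphs (V : finType) (d : nat) : {set {set {set V}}} :=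
  [set E | simple_graph E && [forall v, degree E v == d]]%SET.

Definition connected_graph (V : finType) (E : {set {set V}}) : bool :=
  (0 < #|V|)%N && [forall u, forall v, connect (adj_rel E) u v].

Definition acyclic (V : finType) (E : {set {set V}}) : Prop :=
  forall c : seq V, (3 <= size c)%N -> ~ ucycle (adj_rel E) c.

Definition spanning_tree (V : finType) (E T : {set {set V}}) : Prop :=
  [/\ T \subset E, connected_graph T & acyclic T].

Definition edge (V : finType) (E : {set {set V}}) := {e : {set V} | e \in E}.

Definition colour_count (V : finType) (E : {set {set V}}) (r : nat)
    (f : {ffun edge E -> 'I_r}) (T : {set {set V}}) (i : 'I_r) : nat :=
  #|[set e : edge E | (f e == i) && (val e \in T)]%SET|.

Definition tree_discrepancy (R : realType) (V : finType) (E : {set {set V}})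
    (r : nat) (f : {ffun edge E -> 'I_r}) (T : {set {set V}}) : R :=
  r%:R * ((\max_(i < r) colour_count f T i)%N%:R - (#|V|%:R - 1) / r%:R).

(* There are finitely many colourings and spanning trees, so when E is
   connected and r > 0 the infimum is a minimum and the supremum a maximum.
   For disconnected E the value is meaningless. *)
Definition discrepancy (R : realType) (V : finType) (E : {set {set V}})
    (r : nat) : R :=
  inf (range (fun f : {ffun edge E -> 'I_r} =>
    sup [set tree_discrepancy R f T | T in spanning_tree E]%classic)).

(* The probability that a uniformly random element of S satisfies A; it is 0
   by convention when S is empty. *)
Definition uniform_probability (R : realType) (X : finType) (S : {set X})
    (A : X -> Prop) : R :=
  #|[set x in S | `[< A x >]]%SET|%:R / #|S|%:R.

(* Main.v *)
Require Import Defs.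
From HB Require Import structures.
From mathcomp Require Import all_boot all_order all_algebra.
From mathcomp Require Import zify.
Set Implicit Arguments.
Unset Strict Implicit.
Unset Printing Implicit Defensive.

(** In a connected graph with n vertices, a spanning forest of the i-th colour
    class extends to a spanning tree, so some spanning tree has n - k_i edges of
    colour i, where k_i is the number of components of that class.  If every
    n - k_i were at most (1 + 1/M) n / r, no component C of a colour class would
    have much more than n/2 vertices, and the numbers |C| - 1, summed over all
    colours and components, would be at most (1 + 1/M) n.  Now suppose that every
    set S with 4 <= |S| <= n/2 spans fewer than (d/2 - 1/q)(|S| - 1) edges, and
    that there are few triangles.  Passing to complements, every component C
    spans at most (d/2 - 1/(2q))(|C| - 1) edges, up to the triangles, so fewer
    than dn/2 edges would be coloured: a contradiction.  The same property of S
    yields connectedness.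

    That random regular graphs have this property is a first moment estimate.
    Fix S with |S| = k and let T_x be the number of d-regular graphs with x edges
    leaving S.  Replacing an edge uv inside S and an edge pq outside S by up and
    vq shows T_x (dk - x)(d(n-k) - x - 2d^2) <= T_(x+2) (x+1)(x+2).  Hence
    T_x^2 / V_x is nondecreasing along x, x+2, ..., where
    V_x = 'C(dk, x) 'C(d(n-k) - 2d^2, x).  For small k compare x with dk; for
    large k sum over all y, since the V_y add up to a binomial coefficient that
    is at least of order 'C(n, k)^d, which beats the 'C(n, k) choices of S. *)

(** * Switchings *)

Lemma card_fibred (X Y : finType) (P : pred X) (Q : X -> pred Y) :
  #|[set w : X * Y | P w.1 && Q w.1 w.2]| = \sum_(x | P x) #|[set y | Q x y]|.
Proof.
rewrite -sum1_card.
rewrite (eq_bigl (fun w : X * Y => P w.1 && Q w.1 w.2)); last by move=> w; rewrite inE.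
rewrite -(pair_big_dep P Q (fun _ _ => 1)) /=.
by apply: eq_bigr => x _; rewrite -sum1_card; apply: eq_bigl => y; rewrite inE.
Qed.

Section Graphs.
Variable V : finType.
Implicit Types (E : {set {set V}}) (S : {set V}) (u v p q x y : V).

Definition arcs E S : {set V * V} :=
  [set a | [&& a.1 \in S, a.2 \in S & adj_rel E a.1 a.2]].

Definition cut E S : {set V * V} :=
  [set a | [&& a.1 \in S, a.2 \notin S & adj_rel E a.1 a.2]].

Lemma adj_sym E : symmetric (adj_rel E).
Proof. by move=> u v; rewrite /adj_rel setUC. Qed.

Lemma doubleton_eq u v x y :
  ([set u; v] == [set x; y]) = ((u == x) && (v == y)) || ((u == y) && (v == x)).
Proof.
apply/eqP/idP => [e|/orP[]/andP[/eqP-> /eqP->] //]; last by rewrite setUC.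
have := set21 u v; have := set22 u v; have := set21 x y; have := set22 x y.
rewrite e -{1 2}e !inE.
by do 4! [case/orP=> /eqP ?]; subst; rewrite ?eqxx ?orbT.
Qed.

Lemma simple_adj_irr E u : simple_graph E -> ~~ adj_rel E u u.
Proof.
move/forall_inP => sE; apply/negP => /sE.
by rewrite setUid cards1.
Qed.

Lemma regular_simple d E : E \in regular_graphs V d -> simple_graph E.
Proof. by rewrite inE => /andP[]. Qed.

Lemma regular_degree d E v : E \in regular_graphs V d ->
  #|[set u | adj_rel E v u]| = d.
Proof. by rewrite inE => /andP[_ /forallP/(_ v)/eqP]. Qed.

Lemma card_arcs_from E d S : E \in regular_graphs V d ->
  #|[set a : V * V | (a.1 \in S) && (adj_rel E a.1 a.2)]| = d * #|S|.
Proof.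
move=> rE; rewrite card_fibred.
rewrite (eq_bigr (fun=> d)) ?sum_nat_const 1?mulnC // => x _.
exact: regular_degree.
Qed.

Lemma card_arcs_cut E d S : E \in regular_graphs V d ->
  #|arcs E S| + #|cut E S| = d * #|S|.
Proof.
move=> rE; rewrite -(card_arcs_from S rE).
rewrite -(cardsID [set a : V * V | a.2 \in S]); congr (_ + _); apply: eq_card => a;
  by rewrite !inE; case: (a.1 \in S); case: (a.2 \in S); case: adj_rel.
Qed.

Lemma card_cutC E S : #|cut E (~: S)| = #|cut E S|.
Proof.
have sw_inj : injective (fun a : V * V => (a.2, a.1)) by move=> [? ?] [? ?] [-> ->].
rewrite -(card_imset (cut E S) sw_inj); apply: eq_card => -[a b].
apply/idP/imsetP => [|[[c e] + [-> ->]]]; rewrite !inE /= ?negbK.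
  by case/and3P=> ? ? ?; exists (b, a); rewrite // !inE /= adj_sym; apply/and3P.
by case/and3P=> -> ->; rewrite adj_sym.
Qed.

Definition switch E u v p q : {set {set V}} :=
  [set u; p] |: ([set v; q] |: ((E :\ [set u; v]) :\ [set p; q])).

Lemma switch_adj E u v p q x y : adj_rel (switch E u v p q) x y =
  [|| (x == u) && (y == p), (x == p) && (y == u), (x == v) && (y == q),
      (x == q) && (y == v)
    | [&& ~~ ((x == u) && (y == v)), ~~ ((x == v) && (y == u)),
          ~~ ((x == p) && (y == q)), ~~ ((x == q) && (y == p)) & adj_rel E x y]].
Proof.
rewrite /adj_rel !inE !doubleton_eq.
by case: (x == u); case: (x == v); case: (x == p); case: (x == q);
  case: (y == u); case: (y == v); case: (y == p); case: (y == q).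
Qed.

Lemma switch_simple E u v p q :
  u != v -> p != q -> v != q -> u != p -> simple_graph E ->
  simple_graph (switch E u v p q).
Proof.
move=> uv pq vq up /forall_inP sE; apply/forall_inP => e; rewrite !inE.
case/or3P=> [/eqP->|/eqP->|/and3P[_ _ /sE//]]; by rewrite cards2 ?up ?vq.
Qed.

Section Switching.
Variables (d : nat) (S : {set V}) (E : {set {set V}}) (u v p q : V).
Hypotheses (rE : E \in regular_graphs V d).
Hypotheses (uS : u \in S) (vS : v \in S) (pS : p \notin S) (qS : q \notin S).
Hypotheses (uv : adj_rel E u v) (pq : adj_rel E p q).
Hypotheses (up : ~~ adj_rel E u p) (vq : ~~ adj_rel E v q).

Let neq x y : x \in S -> y \notin S -> (x == y) = false.
Proof. by move=> xS yS; apply/eqP => xy; rewrite -xy xS in yS. Qed.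
Let uNv : (u == v) = false.
Proof.
by apply/eqP => e; move: uv; rewrite e (negbTE (simple_adj_irr _ (regular_simple rE))).
Qed.
Let pNq : (p == q) = false.
Proof.
by apply/eqP => e; move: pq; rewrite e (negbTE (simple_adj_irr _ (regular_simple rE))).
Qed.
Let uNp := neq uS pS. Let uNq := neq uS qS. Let vNp := neq vS pS. Let vNq := neq vS qS.

Lemma switch_nbhd x : [set y | adj_rel (switch E u v p q) x y] =
  if x == u then p |: [set y | adj_rel E x y] :\ v
  else if x == v then q |: [set y | adj_rel E x y] :\ u
  else if x == p then u |: [set y | adj_rel E x y] :\ q
  else if x == q then v |: [set y | adj_rel E x y] :\ p
  else [set y | adj_rel E x y].
Proof.
apply/setP => y; rewrite inE switch_adj.
case: (eqVneq x u) => [->|xu].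
  rewrite uNv uNp uNq !inE /=; case: (eqVneq y p) => //= _.
case: (eqVneq x v) => [->|xv].
  by rewrite vNp vNq !inE /=; case: (eqVneq y q).
case: (eqVneq x p) => [->|xp].
  by rewrite pNq !inE /=; case: (eqVneq y u).
case: (eqVneq x q) => [->|xq].
  by rewrite !inE /=; case: (eqVneq y v).
by rewrite !inE.
Qed.

Lemma switch_regular : switch E u v p q \in regular_graphs V d.
Proof.
have sE := regular_simple rE.
rewrite inE switch_simple ?uNv ?pNq ?vNq ?uNp //=.
apply/forallP => x; rewrite /degree switch_nbhd.
have card_swap y z : adj_rel E x y -> ~~ adj_rel E x z ->
    #|z |: [set t | adj_rel E x t] :\ y| == d.
  move=> xy xz; rewrite cardsU1 !inE (negbTE xz) andbF /=.
  by rewrite -(regular_degree x rE) [in X in _ == X](cardsD1 y) inE xy.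
case: ifP => [/eqP xE|_]; first by apply: card_swap; rewrite xE.
case: ifP => [/eqP xE|_]; first by apply: card_swap; rewrite xE // adj_sym.
case: ifP => [/eqP xE|_]; first by apply: card_swap; rewrite xE // adj_sym.
case: ifP => [/eqP xE|_]; first by apply: card_swap; rewrite xE // adj_sym.
by rewrite (regular_degree x rE).
Qed.

(** Each deleted edge lies on one side of [S], and both new edges cross from [S] to its
    complement. *)
Lemma switch_cut : #|cut (switch E u v p q) S| = #|cut E S|.+2.
Proof.
have -> : cut (switch E u v p q) S = (u, p) |: ((v, q) |: cut E S).
  apply/setP => -[x y]; rewrite !inE /= switch_adj !xpair_eqE.
  case xS: (x \in S); last first.
    rewrite /= !orbF; apply/esym/norP; split; apply/negP => /andP[/eqP xE _].
      by rewrite xE uS in xS.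
    by rewrite xE vS in xS.
  case yS: (y \in S); rewrite /=.
    apply/esym/norP; rewrite orbF; split; apply/negP => /andP[_ /eqP yE].
      by rewrite yE (negbTE pS) in yS.
    by rewrite yE (negbTE qS) in yS.
  rewrite (neq xS pS) (neq xS qS) ![y == _]eq_sym (neq vS (negbT yS)) (neq uS (negbT yS)).
  by rewrite /= !andbF /=.
rewrite !cardsU1 !inE /= !xpair_eqE uNv /= (negbTE up) (negbTE vq) !andbF //.
Qed.

(** Makes switchings injective: [E] is recovered from the switched graph and the four vertices. *)
Lemma switchK : switch (switch E u v p q) u p v q = E.
Proof.
apply/setP => e; rewrite !inE.
case: (eqVneq e [set u; v]) => [->|nuv] /=; first by rewrite [RHS]uv.
case: (eqVneq e [set p; q]) => [->|npq] /=; first by rewrite [RHS]pq.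
case: (eqVneq e [set v; q]) => [->|nvq] /=; first by rewrite (negbTE vq : _ \in E = false).
case: (eqVneq e [set u; p]) => [->|nup] //=; by rewrite (negbTE up : _ \in E = false).
Qed.
End Switching.

(** Its cardinality is T_x of the introduction, since each edge leaving [S] gives exactly one arc of
    [cut]. *)
Definition cut_graphs d S (x : nat) : {set {set {set V}}} :=
  [set E in regular_graphs V d | #|cut E S| == x].

Lemma card_arcs_near E d v : E \in regular_graphs V d ->
  #|[set a : V * V | adj_rel E v a.1 && adj_rel E a.1 a.2]| = d * d.
Proof.
move=> rE; rewrite -[in X in _ = _ * X](regular_degree v rE) -(card_arcs_from _ rE).
by apply: eq_card => a; rewrite !inE.
Qed.

(** Double counting: [phi] embeds [X], the graphs with cut x together with an admissible switching,
    into [Y], the graphs with cut x + 2 together with two distinct cut arcs. *)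
Lemma switching d S (x : nat) :
  #|cut_graphs d S x| * ((d * #|S| - x) * (d * #|~: S| - x - 2 * d ^ 2))
  <= #|cut_graphs d S x.+2| * (x.+1 * x.+2).
Proof.
pose ok E (t : (V * V) * (V * V)) := [&& t.1 \in arcs E S, t.2 \in arcs E (~: S),
  ~~ adj_rel E t.1.1 t.2.1 & ~~ adj_rel E t.1.2 t.2.2].
pose X := [set w : {set {set V}} * ((V * V) * (V * V)) |
  (w.1 \in cut_graphs d S x) && ok w.1 w.2].
pose ok' E (t : (V * V) * (V * V)) := ((t.1.1, t.2.1) \in cut E S) &&
   (((t.1.2, t.2.2) \in cut E S) && ((t.1.2, t.2.2) != (t.1.1, t.2.1))).
pose Y := [set w : {set {set V}} * ((V * V) * (V * V)) |
  (w.1 \in cut_graphs d S x.+2) && ok' w.1 w.2].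
pose phi (w : {set {set V}} * ((V * V) * (V * V))) :=
  (switch w.1 w.2.1.1 w.2.1.2 w.2.2.1 w.2.2.2, w.2).
have okP E u v p q : ok E ((u, v), (p, q)) -> [/\ [/\ u \in S, v \in S, p \notin S & q \notin S],
    adj_rel E u v, adj_rel E p q, ~~ adj_rel E u p & ~~ adj_rel E v q].
  by rewrite /ok !inE /= => /and4P[/and3P[-> -> ->] /and3P[-> -> ->] -> ->].
have XY : phi @: X \subset Y.
  apply/subsetP => _ /imsetP[[E [[u v] [p q]]] + ->].
  rewrite inE /= => /andP[+ /okP[[uS vS pS qS] uv pq up vq]].
  rewrite inE => /andP[rE /eqP cE].
  rewrite 2!inE /= (switch_regular rE uS vS) //= (switch_cut rE uS vS) // cE eqxx /=.
  rewrite /ok' /= !inE /= uS vS pS qS !switch_adj !eqxx /= ?orbT /= xpair_eqE.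
  by apply/negP => /andP[/eqP vu _]; move: uv; rewrite vu (negbTE (simple_adj_irr _ (regular_simple rE))).
have phi_inj : {in X &, injective phi}.
  move=> [E [[u v] [p q]]] [E' t'] + + [eS et]; rewrite -et in eS *; rewrite !inE /=.
  move=> /andP[/andP[rE _] /okP[[uS vS pS qS] uv pq up vq]].
  move=> /andP[/andP[rE' _] /okP[_ uv' pq' up' vq']].
  congr pair; rewrite -(switchK uv pq up vq) eS; exact: switchK.
have : #|X| <= #|Y| by rewrite -(card_in_imset phi_inj); apply: subset_leq_card.
rewrite !card_fibred => XY'; apply: leq_trans (leq_trans XY' _).
  rewrite -sum_nat_const; apply: leq_sum => E; rewrite inE => /andP[rE /eqP cE].
  rewrite (card_fibred (mem (arcs E S)) (fun a b => [&& b \in arcs E (~: S),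
    ~~ adj_rel E a.1 b.1 & ~~ adj_rel E a.2 b.2])).
  have <- : #|arcs E S| = d * #|S| - x by rewrite -(card_arcs_cut S rE) cE addnK.
  rewrite -sum_nat_const; apply: leq_sum => -[u v] uv.
  have <- : #|arcs E (~: S)| = d * #|~: S| - x.
    by rewrite -(card_arcs_cut (~: S) rE) card_cutC cE addnK.
  (* For a fixed arc uv, an arc pq outside [S] is forbidden when up or vq is already an edge; each
     condition excludes at most d^2 arcs. *)
  pose B1 := [set a : V * V | adj_rel E u a.1 && adj_rel E a.1 a.2].
  pose B2 := [set a : V * V | adj_rel E v a.2 && adj_rel E a.1 a.2].
  have B1d : #|B1| = d ^ 2 by rewrite (card_arcs_near u rE) mulnn.
  have B2d : #|B2| = d ^ 2.
    rewrite -mulnn -(card_arcs_near v rE).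
    have sw_inj : injective (fun a : V * V => (a.2, a.1)) by move=> [? ?] [? ?] [-> ->].
    rewrite -[RHS](card_imset _ sw_inj); apply: eq_card => -[a b].
    rewrite inE /=; apply/idP/imsetP => [/andP[h1 h2]|[[a' b'] + [-> ->]]].
      by exists (b, a); rewrite // inE /= h1 adj_sym.
    by rewrite inE /= adj_sym [adj_rel E b' a']adj_sym andbC => /andP[-> ->].
  rewrite leq_subLR mul2n -addnn -{1}B1d -B2d.
  apply: leq_trans (leq_trans (leq_card_setU (B1 :|: B2) _) _); last first.
    by apply: leq_add (leqnn _); apply: leq_card_setU.
  apply: subset_leq_card; apply/subsetP => -[a b]; rewrite !inE /=.
  move=> /and3P[-> -> ->] /=.
  by case: (adj_rel E u a); case: (adj_rel E v b).
rewrite -sum_nat_const; apply: leq_sum => E E_in.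
have {E_in} : E \in cut_graphs d S x.+2 by [].
rewrite inE => /andP[rE /eqP cE].
(* Regrouped by its new edges, a switching is an ordered pair of distinct cut arcs, so there are at
   most (x + 2)(x + 1) of them. *)
pose psi (t : (V * V) * (V * V)) := ((t.1.1, t.2.1), (t.1.2, t.2.2)).
have psi_inj : injective psi by move=> [[? ?] [? ?]] [[? ?] [? ?]] [-> -> -> ->].
rewrite -(card_imset _ psi_inj).
pose D := [set w : (V * V) * (V * V) | (w.1 \in cut E S) && ((w.2 \in cut E S) && (w.2 != w.1))].
apply: (@leq_trans #|D|).
  apply: subset_leq_card; apply/subsetP => _ /imsetP[t + ->].
  by rewrite inE /ok' => ht; rewrite inE.
rewrite (card_fibred (mem (cut E S)) (fun a b => (b \in cut E S) && (b != a))).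
rewrite (eq_bigr (fun=> x.+1)); first by rewrite sum_nat_const cE mulnC.
move=> a aE; have -> : [set b | (b \in cut E S) && (b != a)] = cut E S :\ a.
  by apply/setP => b; rewrite !inE andbC.
by have := cardsD1 a (cut E S); rewrite (aE : a \in cut E S) cE => -[].
Qed.

End Graphs.

(** * Estimates from the switching inequality *)

(* The weight V_x of the introduction. *)
Definition bin_prod a b x := 'C(a, x) * 'C(b, x).

Lemma bin_prodS2 a b x : bin_prod a b x.+2 * (x.+1 * x.+2) ^ 2 =
  bin_prod a b x * (((a - x) * (a - x.+1)) * ((b - x) * (b - x.+1))).
Proof.
have h n : 'C(n, x.+2) * (x.+1 * x.+2) = 'C(n, x) * ((n - x) * (n - x.+1)).
  have := mul_bin_left n x; have := mul_bin_left n x.+1.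
  move: (n - x) (n - x.+1) => a' b' h2 h1.
  rewrite [x.+1 * _]mulnC mulnA [_ * x.+2]mulnC h2 -mulnA [_ * x.+1]mulnC h1; lia.
by rewrite /bin_prod -mulnn mulnACA !h mulnACA.
Qed.

Lemma bin_le_pow2 n k : 'C(n, k) <= 2 ^ n.
Proof.
have [kn|nk] := leqP k n; last by rewrite bin_small.
have := expnDn 1 1 n; rewrite addn1 => ->.
have ko : k < n.+1 by [].
by rewrite (bigD1 (Ordinal ko)) //= !exp1n !muln1 leq_addr.
Qed.

Section Chain.
Variables (T : nat -> nat) (tot a b : nat).
Hypothesis T_le : forall x, T x <= tot.
Hypothesis T_switch : forall x, T x * ((a - x) * (b - x)) <= T x.+2 * (x.+1 * x.+2).

(** The ratio V_(x+2) / V_x is (a-x)(a-x-1)(b-x)(b-x-1) / ((x+1)(x+2))^2, at most the square of the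
    growth factor (a-x)(b-x) / ((x+1)(x+2)) in [T_switch]. *)
Lemma chain_step x : T x ^ 2 * bin_prod a b x.+2 <= T x.+2 ^ 2 * bin_prod a b x.
Proof.
rewrite -(@leq_pmul2r ((x.+1 * x.+2) ^ 2)) ?expn_gt0 //.
rewrite -mulnA bin_prodS2 mulnCA -[X in _ <= X]mulnA [bin_prod _ _ _ * _ ^ 2]mulnC.
rewrite [X in _ <= X]mulnA [X in _ <= X]mulnC -expnMn leq_mul2l; apply/orP; right.
apply: leq_trans (_ : (T x * ((a - x) * (b - x))) ^ 2 <= _); last by rewrite leq_sqr.
rewrite expnMn leq_mul2l; apply/orP; right.
rewrite expnMn -!mulnn leq_mul // leq_mul2l ?leq_sub2l ?orbT //.
Qed.

Lemma chain x m : T x ^ 2 * bin_prod a b (x + m.*2) <= T (x + m.*2) ^ 2 * bin_prod a b x.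
Proof.
elim: m => [|m IH]; first by rewrite addn0.
rewrite doubleS !addnS; set y := x + m.*2 in IH *.
(* The induction cancels V_y; if V_y vanishes then so does V_(y+2), and the claim is trivial. *)
have [V0|V0] := posnP (bin_prod a b y).
  suff -> : bin_prod a b y.+2 = 0 by rewrite muln0.
  have /eqP := bin_prodS2 a b y; rewrite V0 mul0n muln_eq0 => /orP[/eqP//|].
  by rewrite expn_eq0.
rewrite -(leq_pmul2r V0).
have := chain_step y; move: IH V0; move: (bin_prod a b y) (bin_prod a b y.+2) (bin_prod a b x).
move: (T x ^ 2) (T y ^ 2) (T y.+2 ^ 2) => A B C v v2 vx h1 v0 h2.
have h3 : A * v * v2 <= B * vx * v2 by rewrite leq_mul2r h1 orbT.
have h4 : B * v2 * vx <= C * v * vx by rewrite leq_mul2r h2 orbT.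
lia.
Qed.

Lemma chain_tot x y : x <= y -> ~~ odd (y - x) ->
  T x ^ 2 * bin_prod a b y <= tot ^ 2 * bin_prod a b x.
Proof.
move=> xy ev; have -> : y = x + (y - x)./2.*2 by rewrite even_halfK ?subnKC.
by apply: leq_trans (chain _ _) _; rewrite leq_mul2r leq_sqr T_le orbT.
Qed.

(** Each of the j ratios of consecutive coefficients is at least (n - (x + j)) / (x + j). *)
Lemma bin_shift n x j : 'C(n, x) * (n - (x + j)) ^ j <= 'C(n, x + j) * (x + j) ^ j.
Proof.
suff h i : i <= j -> 'C(n, x) * (n - (x + j)) ^ i <= 'C(n, x + i) * (x + j) ^ i by apply: h.
elim: i => [|i IH] ij; first by rewrite addn0.
rewrite addnS !expnSr mulnA.
apply: leq_trans (_ : 'C(n, x + i) * (x + j) ^ i * (n - (x + j)) <= _).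
  by rewrite leq_mul2r IH ?orbT // ltnW.
have h : 'C(n, x + i) * (n - (x + j)) <= 'C(n, (x + i).+1) * (x + j).
  apply: (@leq_trans ('C(n, x + i) * (n - (x + i)))).
    by rewrite leq_mul2l; apply/orP; right; lia.
  rewrite mulnC -mul_bin_left mulnC leq_mul2l; lia.
by rewrite mulnAC [X in _ <= X]mulnA [X in _ <= X]mulnAC leq_mul2r h orbT.
Qed.

(** Compares [x] with the end [a] of the chain, where ['C(a, a)] is 1: T_x^2 is at most tot^2 times
    ['C(a, x) * 'C(b, x)] over ['C(b, a)], and [bin_shift] bounds the quotient of the last two. *)
Lemma small_set x m : x + m.*2 = a -> a <= b -> T x * (b - a) ^ m <= tot * (2 ^ a * a ^ m).
Proof.
move=> xa ab; rewrite -leq_sqr !expnMn.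
have xla : x <= a by rewrite -xa leq_addr.
have /(chain_tot xla) : ~~ odd (a - x) by rewrite -xa addKn odd_double.
rewrite /bin_prod binn mul1n => h.
have b0 : 0 < 'C(b, a) by rewrite bin_gt0.
have := bin_shift b x m.*2; rewrite xa -!muln2 !expnM => h2.
(* Stated with a perfect square so that the final square root is exact. *)
have bin_le : 'C(a, x) <= (2 ^ a) ^ 2.
  apply: (@leq_trans (2 ^ a)); last by rewrite -expnM leq_exp2l // muln2 -addnn leq_addl.
  exact: bin_le_pow2.
move: h h2 b0 bin_le; move: ('C(a, x)) ('C(b, x)) ('C(b, a)) (T x ^ 2) (tot ^ 2).
move: (((b - a) ^ m) ^ 2) ((a ^ m) ^ 2) ((2 ^ a) ^ 2) => p q r A B C t u h h2 C0 hA.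
rewrite -(leq_pmul2r C0).
apply: (@leq_trans (u * (A * B) * p)); first by rewrite mulnAC leq_mul2r h orbT.
rewrite -!mulnA leq_mul2l; apply/orP; right.
apply: leq_trans (leq_mul hA h2) _; lia.
Qed.

(** Sums T_x^2 V_y over all y by Vandermonde's identity. For y <= x, V_y is at most W^2; for y > x
    of the same parity the chain leads back to V_x; the factor N^2 covers the other parity. *)
Lemma large_set x W N : a <= N -> b <= N -> 0 < N ->
  (forall y, y <= x -> 'C(N, y) <= W) ->
  T x ^ 2 * 'C(a + b, a) <= a.+1 * (N ^ 2 * (W ^ 2 * tot ^ 2)).
Proof.
move=> aN bN N0 CW.
have VW y : y <= x -> bin_prod a b y <= W ^ 2.
  move=> yx; rewrite /bin_prod -mulnn leq_mul //; apply: leq_trans (CW _ yx);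
    exact: leq_bin2l.
have main y : T x ^ 2 * bin_prod a b y <= N ^ 2 * (W ^ 2 * tot ^ 2).
  have N2 : 0 < N ^ 2 by rewrite expn_gt0 N0.
  have same z : x <= z -> ~~ odd (z - x) -> T x ^ 2 * bin_prod a b z <= W ^ 2 * tot ^ 2.
    move=> xz ev; apply: leq_trans (chain_tot xz ev) _.
    by rewrite mulnC leq_mul2r VW ?orbT.
  have [yx|xy] := leqP y x.
    apply: leq_trans (leq_pmull _ N2).
    by rewrite mulnC leq_mul // ?VW // leq_sqr.
  have [ev|/negPn od] := boolP (~~ odd (y - x)).
    by apply: leq_trans (leq_pmull _ N2); apply: same ev; apply: ltnW.
  (* Wrong parity: go back to the predecessor of y, at a cost of at most [N] for each of the two
     binomial coefficients. *)
  case: y xy od => // y xy od.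
  have ev : ~~ odd (y - x) by move: od; rewrite subSn.
  apply: leq_trans (_ : N ^ 2 * (T x ^ 2 * bin_prod a b y) <= _); last first.
    by rewrite leq_mul2l same ?orbT.
  rewrite mulnCA leq_mul2l; apply/orP; right.
  have h n : n <= N -> 'C(n, y.+1) <= N * 'C(n, y).
    move=> nN; apply: leq_trans (_ : y.+1 * 'C(n, y.+1) <= _); first exact: leq_pmull.
    by rewrite mul_bin_left leq_mul2r (leq_trans (leq_subr _ _) nN) orbT.
  by rewrite /bin_prod -mulnn mulnACA leq_mul ?h.
rewrite [a + b]addnC -binomial.Vandermonde big_distrr /=.
apply: leq_trans (_ : \sum_(i < a.+1) N ^ 2 * (W ^ 2 * tot ^ 2) <= _); last first.
  by rewrite sum_nat_const card_ord.
apply: leq_sum => -[y /= ya] _; rewrite bin_sub // ['C(b, y) * _]mulnC; exact: main.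
Qed.
End Chain.

(** * Elementary bounds on binomial coefficients and powers *)

Lemma ffact_le_exp n k : n ^_ k <= n ^ k.
Proof.
elim: k => [|k IH]; first by rewrite ffactn0.
by rewrite ffactnSr expnSr leq_mul // leq_subr.
Qed.

Lemma exp_le_ffact n k : n ^ k <= (n + k) ^_ k.
Proof.
elim: k => [|k IH]; first by rewrite ffactn0.
rewrite addnS ffactSS expnS; apply: leq_mul => //; lia.
Qed.

(** The bound (4n/k)^k; the 4 arises from k^k <= (2k)!/k! = ['C(k + k, k)] k! <= 4^k k!. *)
Lemma bin_le_exp n k : 'C(n, k) * k ^ k <= 4 ^ k * n ^ k.
Proof.
have h : k ^ k <= 4 ^ k * k`!.
  apply: leq_trans (exp_le_ffact k k) _; rewrite -bin_ffact leq_mul2r.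
  by rewrite (leq_trans (bin_le_pow2 _ _)) ?orbT // addnn -mul2n expnM.
apply: (@leq_trans ('C(n, k) * (4 ^ k * k`!))); first by rewrite leq_mul2l h orbT.
by rewrite mulnCA leq_mul2l bin_ffact ffact_le_exp orbT.
Qed.

Lemma bin_ge_pow2 n k : 2 * k <= n -> 2 ^ k <= 'C(n, k).
Proof.
elim: k n => [|k IH] n kn; first by rewrite bin0.
case: n kn => [|[|n]] kn; try lia.
have /IH h : 2 * k <= n by lia.
by rewrite binS binS expnS; have := leq_bin2l k (leqnSn n); lia.
Qed.

Lemma bin_mul_ge m k m' k' : 'C(m, k) * 'C(m', k') <= 'C(m + m', k + k').
Proof.
rewrite -binomial.Vandermonde.
have ko : k < (k + k').+1 by rewrite ltnS leq_addr.
by rewrite (bigD1 (Ordinal ko)) //= addKn leq_addr.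
Qed.

Lemma bin_exp_ge d m k : 'C(m, k) ^ d <= 'C(d * m, d * k).
Proof.
elim: d => [|d IH]; first by rewrite bin0.
rewrite expnS !mulSn; apply: leq_trans (bin_mul_ge _ _ _ _).
by rewrite leq_mul2l IH orbT.
Qed.

(** Passing from m to m - 1 points multiplies ['C(m, k)] by (m - k)/m, which is at least 1/3 as long
    as m >= 3n/4 and k <= n/2. *)
Lemma bin_sub_ge n k j : 2 * k <= n -> 4 * j <= n -> 'C(n, k) <= 3 ^ j * 'C(n - j, k).
Proof.
move=> kn; elim: j => [|j IH] jn; first by rewrite subn0 mul1n.
apply: leq_trans (IH _) _; first lia.
rewrite expnSr -mulnA leq_mul2l; apply/orP; right.
have -> : n - j.+1 = (n - j).-1 by lia.
have h := mul_bin_down (n - j) k.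
have p : 0 < n - j - k by lia.
rewrite -(leq_pmul2l p) -h mulnA leq_mul2r; apply/orP; right; lia.
Qed.

(** Bernoulli's inequality (1 - 1/(s+1))^h >= 1 - h/(s+1), cleared of denominators. *)
Lemma bernoulli s h : h <= s -> s.+1 ^ h * (s.+1 - h) <= s ^ h * s.+1.
Proof.
elim: h => [|h IH] hs; first by rewrite subn0.
have {IH} := IH (ltnW hs); rewrite !expnS; move: (s.+1 ^ h) (s ^ h) => A B IH.
apply: (@leq_trans (s * (A * (s.+1 - h)))); last first.
  by rewrite -mulnA leq_mul2l IH orbT.
have -> : s.+1 - h.+1 = s - h by lia.
have -> : s.+1 - h = (s - h).+1 by lia.
have k : s.+1 * (s - h) <= s * (s - h).+1 by rewrite mulSn mulnS leq_add2r; lia.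
have := leq_mul (leqnn A) k; lia.
Qed.

(** Bernoulli's inequality at s = 2h gives (1 + 1/(2h))^h <= (2h+1)/(h+1) <= 2; raise this to the
    power j. *)
Lemma exp_succ_le h j N : N <= h * j -> (2 * h).+1 ^ N <= 2 ^ j * (2 * h) ^ N.
Proof.
have [->|h0] := posnP h; first by rewrite mul0n leqn0 => /eqP->; rewrite muln1 expn_gt0.
move=> Nj.
have mono a b e : a <= b -> a ^ e <= b ^ e.
  by case: e => [|e] // ab; rewrite leq_exp2r.
have half : (2 * h).+1 ^ h <= 2 * (2 * h) ^ h.
  have hs : h <= 2 * h by lia.
  have := bernoulli hs; move: ((2 * h) ^ h) ((2 * h).+1 ^ h) => A B.
  have -> : (2 * h).+1 - h = h.+1 by lia.
  nia.
have s0 : 0 < (2 * h) ^ (h * j - N) by rewrite expn_gt0; lia.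
rewrite -(leq_pmul2r s0) -mulnA -expnD subnKC //.
apply: (@leq_trans ((2 * h).+1 ^ (h * j))).
  rewrite -[in X in _ <= X](subnKC Nj) expnD leq_mul2l mono ?orbT //.
by rewrite !expnM -expnMn mono.
Qed.

(** A single term of the expansion of (s + 1)^N. Read as ['C(N, y)] <= (1 + 1/s)^N s^y, it is strong
    for large s when y is a small fraction of N. *)
Lemma bin_le_exp_succ N y s : 0 < s -> 'C(N, y) * s ^ N <= s.+1 ^ N * s ^ y.
Proof.
move=> s0; have [yN|Ny] := leqP y N; last by rewrite bin_small.
have yo : y < N.+1 by [].
have -> : s ^ N = s ^ (N - y) * s ^ y by rewrite -expnD subnK.
rewrite mulnA leq_mul2r; apply/orP; right.
rewrite -[s.+1]addn1 expnDn (bigD1 (Ordinal yo)) //= exp1n muln1.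
by rewrite leq_addr.
Qed.

(** * The two estimates for a fixed set: small k and large k *)

Section Estimates.
Variables (T : nat -> nat) (tot n k d : nat).
Hypothesis T_le : forall x, T x <= tot.
Hypothesis T_switch : forall x,
  T x * ((d * k - x) * (d * (n - k) - x - 2 * d ^ 2)) <= T x.+2 * (x.+1 * x.+2).
Hypothesis d0 : 0 < d.

Let T_switch' x :
  T x * ((d * k - x) * (d * (n - k) - 2 * d ^ 2 - x)) <= T x.+2 * (x.+1 * x.+2).
Proof. by rewrite subnAC. Qed.

(** [small_set] with a = dk and b = d(n - k) - 2d^2, where b - a >= dn/2; [m] stands for the number
    of edges inside the set. *)
Lemma small_prob x m : 4 * (k + d) <= n -> x + m.*2 = d * k ->
  T x * n ^ m <= tot * (2 ^ (d * k) * (2 * k) ^ m).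
Proof.
move=> kn xm.
have e : d * (n - k) - 2 * d ^ 2 - d * k = d * (n - 2 * k - 2 * d).
  by rewrite -mulnn [2 * _]mulnCA -!mulnBr; congr (_ * _); lia.
have ab : d * k <= d * (n - k) - 2 * d ^ 2.
  rewrite -mulnn [2 * _]mulnCA -!mulnBr leq_mul2l; lia.
have := small_set T_le T_switch' xm ab; rewrite e => h.
have mono a b : a <= b -> a ^ m <= b ^ m.
  by case: (m) => [|l] // ab'; rewrite leq_exp2r.
have d_gt0 : 0 < d ^ m by rewrite expn_gt0 d0.
rewrite -(leq_pmul2r d_gt0) -mulnA -expnMn.
apply: (@leq_trans (T x * (2 ^ m * (d * (n - 2 * k - 2 * d)) ^ m))).
  rewrite leq_mul2l -expnMn mono ?orbT // mulnC mulnCA leq_mul2l; lia.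
rewrite mulnCA; apply: (@leq_trans (2 ^ m * (tot * (2 ^ (d * k) * (d * k) ^ m)))).
  by rewrite leq_mul2l h orbT.
rewrite !expnMn; lia.
Qed.

(** Of the k + g gains of n/(2k) in [small_prob], k pay for the choice of the set, up to a factor
    8^k, by [bin_le_exp]. *)
Lemma small_count x g : 0 < k -> 4 * (k + d) <= n -> x + (k + g).*2 = d * k ->
  T x * 'C(n, k) * n ^ g <= tot * (2 ^ ((d + 3) * k) * (2 * k) ^ g).
Proof.
move=> k0 kn xm; have := bin_le_exp n k; have := small_prob kn xm.
have c0 : 0 < n ^ k * k ^ k by rewrite muln_gt0 !expn_gt0 k0 /=; lia.
rewrite (mulnDl d) !expnD !expnMn.
rewrite (_ : 4 ^ k = 2 ^ k * 2 ^ k); last by rewrite -expnMn.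
rewrite expn0 muln1 => h2 h1; rewrite -(leq_pmul2r c0).
have := leq_mul h1 h2; lia.
Qed.

(** One power of n is kept as the final gain. Each of the other g ratios n/(2k) is at least
    2^(5d+35); together they absorb 2^((d+3)k) and leave the 8^k that makes the sum over k
    converge. *)
Lemma small_bound x g : 0 < k -> k * 2 ^ (5 * d + 36) <= n ->
  x + (k + g.+1).*2 = d * k -> k <= 5 * g.+1 ->
  T x * 'C(n, k) * (n * 8 ^ k) <= 2 ^ (5 * d + 36) * tot.
Proof.
move=> k0 kn xm kg.
have L : 2 ^ (5 * d + 36) = 2 * 2 ^ (5 * d + 35) by rewrite -expnS; congr (_ ^ _); lia.
have kn4 : 4 * (k + d) <= n.
  apply: leq_trans kn; apply: (@leq_trans (k * (4 * d.+1))).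
    have := leq_mul k0 (leqnn d); lia.
  rewrite leq_mul2l; apply/orP; right; apply: (@leq_trans (2 ^ (d + 2))).
    by rewrite expnD mulnC leq_mul2r ltn_expl.
  by rewrite leq_exp2l //; lia.
have := small_count k0 kn4 xm.
rewrite L in kn *; set P := 2 ^ (5 * d + 35) in kn *.
have P0 : 0 < P by rewrite expn_gt0.
have mono a b e : a <= b -> a ^ e <= b ^ e.
  by case: e => [|e] // ab; rewrite leq_exp2r.
have hg : (2 * k) ^ g * P ^ g <= n ^ g by rewrite -expnMn mono //; lia.
(* The exponent 5d + 35 is five times d + 7, matching k <= 5(g + 1); of 2^((d+7)k), the part beyond
   2^((d+3)k) covers 8^k and a factor k <= 2^k. *)
have hP : 2 ^ ((d + 7) * k) <= P * P ^ g.
  rewrite -expnS -expnM leq_exp2l //.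
  by apply: (@leq_trans ((d + 7) * (5 * g.+1))); [rewrite leq_mul2l kg orbT | lia].
have k2 : k <= 2 ^ k by apply: ltnW; apply: ltn_expl.
have e7 : 2 ^ ((d + 7) * k) = 2 ^ ((d + 3) * k) * (8 ^ k * 2 ^ k).
  by rewrite -expnMn -(expnM 2 4) -expnD; congr (_ ^ _); lia.
have z0 : 0 < 2 ^ ((d + 3) * k) by rewrite expn_gt0.
have y0 : 0 < (2 * k) ^ g by rewrite expn_gt0; lia.
have w0 : 0 < 2 ^ k by rewrite expn_gt0.
rewrite !expnS; move: hg hP k2 z0 y0 w0; rewrite e7.
move: (2 ^ ((d + 3) * k)) ((2 * k) ^ g) (P ^ g) (n ^ g) (8 ^ k) (2 ^ k) (T x * 'C(n, k)).
move=> z y p ng e w t hg hP k2 z0 y0 w0 h.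
have h1 : t * n * p <= tot * z * (2 * k).
  rewrite -(leq_pmul2r y0); have := leq_mul (leqnn (t * n)) hg; lia.
have h2 : t * n * (z * (e * w)) <= tot * z * (2 * k) * P.
  apply: (@leq_trans (t * n * (P * p))); first by rewrite leq_mul2l hP orbT.
  have := leq_mul h1 (leqnn P); lia.
rewrite -(leq_pmul2r w0) -(leq_pmul2r z0).
have := leq_mul (leqnn (tot * z * P * 2)) k2; lia.
Qed.

(** Chosen so that dn <= h(j + 1), where j is k/16 rounded down, once n <= k 2^(5d+36); this is the
    hypothesis of [exp_succ_le]. *)
Let h := 16 * d * 2 ^ (5 * d + 36).
Definition large_const := 2 * 3 ^ (2 * d * d) * d ^ 3 * (16 * 2 ^ (5 * d + 36)) ^ 9
  * 2 ^ (4 * (h * d) + 4).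

(** As [x] is at most d + k/(32h), each ['C(d * n, y)] with y <= x is at most 2^(2j + 2hd + 2), j
    being k/16 rounded down. Then [large_set] bounds T_x^2 ['C(n, k) ^ 3] by a constant times n^3
    2^(4j) tot^2, and one spare factor ['C(n, k)], at least 2^(16j), absorbs the powers of n. *)
Lemma large_bound x : 3 <= d -> n <= k * 2 ^ (5 * d + 36) -> 2 * k <= n -> 8 * d <= n ->
  32 * (2 * h) * x <= d * (32 * (2 * h)) + 2 * k ->
  T x * 'C(n, k) * n ^ 3 <= large_const * tot.
Proof.
move=> d3; rewrite /large_const /h; set L := 2 ^ (5 * d + 36) => nk kn dn; rewrite -/h.
have L0 : 0 < L by rewrite expn_gt0.
move=> hx.
set j := k %/ 16.
have kj : k < 16 * j.+1 by rewrite mulnC ltn_ceil.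
have jk : 16 * j <= k by rewrite mulnC leq_trunc_div.
have n0 : 0 < n by apply: leq_trans dn; rewrite muln_gt0.
have h0 : 0 < h by rewrite /h -/L !muln_gt0 d0.
have hd : h = 16 * d * L by [].
have Nh : d * n <= h * j.+1.
  apply: (@leq_trans (d * (k * L))); first by rewrite leq_mul2l nk orbT.
  rewrite hd mulnA mulnAC; have := leq_mul (leqnn (d * L)) (ltnW kj); clear; lia.
have CW y : y <= x -> 'C(d * n, y) <= 2 ^ (2 * j + 2 * h * d + 2).
  move=> yx; have s0 : 0 < 2 * h by rewrite muln_gt0.
  have sN : 0 < (2 * h) ^ (d * n) by rewrite expn_gt0 s0.
  rewrite -(leq_pmul2r sN); apply: leq_trans (bin_le_exp_succ _ _ s0) _.
  apply: (@leq_trans (2 ^ j.+1 * (2 * h) ^ (d * n) * 2 ^ (2 * h * x))).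
    rewrite leq_mul ?exp_succ_le // expnM.
    apply: (@leq_trans ((2 * h) ^ x)); first by rewrite leq_pexp2l.
    by case: (x) => [|x'] //; rewrite leq_exp2r // ltnW // ltn_expl.
  rewrite mulnAC leq_mul2r -expnD leq_exp2l //; apply/orP; right.
  by move: hx kj; move: (2 * h) => s; clear; lia.
have k_le : k <= n by apply: leq_trans kn; rewrite leq_pmull.
have aN : d * k <= d * n by rewrite leq_mul2l k_le orbT.
have bN : d * (n - k) - 2 * d ^ 2 <= d * n.
  by apply: leq_trans (leq_subr _ _) _; rewrite leq_mul2l leq_subr orbT.
have N0 : 0 < d * n by rewrite muln_gt0 d0.
have := large_set T_le T_switch' aN bN N0 CW.
have -> : d * k + (d * (n - k) - 2 * d ^ 2) = d * (n - 2 * d).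
  by rewrite -mulnn [2 * _]mulnCA -mulnBr -mulnDr; congr (_ * _); move: kn dn; clear; lia.
move=> hT.
(* The exponent 3 comes from d >= 3; the factor 3^(2d^2) pays for the 2d vertices lost to the term
   2d^2 of the switching inequality. *)
have hC : 'C(n, k) ^ 3 <= 3 ^ (2 * d * d) * 'C(d * (n - 2 * d), d * k).
  have C0 : 0 < 'C(n, k) by rewrite bin_gt0.
  apply: (@leq_trans ('C(n, k) ^ d)); first by rewrite leq_pexp2l.
  apply: (@leq_trans (3 ^ (2 * d * d) * 'C(n - 2 * d, k) ^ d)).
    by rewrite expnM -expnMn leq_exp2r // bin_sub_ge //; move: dn; clear; lia.
  by rewrite leq_mul2l bin_exp_ge orbT.
have hj : n <= 16 * L * 2 ^ j.
  apply: leq_trans nk _; have := ltn_expl j (isT : 1 < 2) => jj.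
  have k16 : k <= 16 * 2 ^ j by move: kj jj; clear; lia.
  by rewrite mulnAC leq_mul2r k16 orbT.
have hk : 2 ^ (16 * j) <= 'C(n, k).
  by apply: leq_trans (bin_ge_pow2 kn); rewrite leq_exp2l.
have Cpos : 0 < 'C(n, k) by rewrite bin_gt0.
rewrite -leq_sqr.
rewrite -(leq_pmul2r Cpos).
set M := 3 ^ (2 * d * d) in hC *.
have step1 : (T x * 'C(n, k) * n ^ 3) ^ 2 * 'C(n, k) <=
   M * ((d * k).+1 * ((d * n) ^ 2 * ((2 ^ (2 * j + 2 * h * d + 2)) ^ 2 * tot ^ 2))) * n ^ 6.
  have -> : (T x * 'C(n, k) * n ^ 3) ^ 2 * 'C(n, k) = T x ^ 2 * 'C(n, k) ^ 3 * n ^ 6.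
    by rewrite !expnMn !expnSr !expn0; clear; lia.
  rewrite leq_mul2r; apply/orP; right.
  apply: (@leq_trans (T x ^ 2 * (M * 'C(d * (n - 2 * d), d * k)))).
    by rewrite leq_mul2l hC orbT.
  by rewrite mulnCA leq_mul2l hT orbT.
apply: leq_trans step1 _.
have dk1 : (d * k).+1 <= 2 * d * n.
  have := leq_mul d0 n0; move: aN; clear; lia.
apply: (@leq_trans (M * (2 * d * n * ((d * n) ^ 2 * ((2 ^ (2 * j + 2 * h * d + 2)) ^ 2 * tot ^ 2))) * n ^ 6)).
  by rewrite leq_mul2r leq_mul2l leq_mul2r dk1 !orbT.
set K := 2 * M * d ^ 3 * (16 * L) ^ 9 * 2 ^ (4 * (h * d) + 4).
apply: (@leq_trans (K * tot ^ 2 * 'C(n, k))); last first.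
  rewrite leq_mul2r expnMn leq_mul2r; apply/orP; right; apply/orP; right.
  have K0 : 0 < K by rewrite /K /M !(muln_gt0, expn_gt0) d0.
  by rewrite -[X in X <= _]expn1 leq_pexp2l.
apply: (@leq_trans (K * tot ^ 2 * 2 ^ (16 * j))); last by rewrite leq_mul2l hk orbT.
(* Here n^3 comes from [large_set] and n^6 from squaring the claim; 9 + 4 <= 16 closes the
   estimate. *)
have h9 : n ^ 9 <= (16 * L) ^ 9 * 2 ^ (9 * j).
  by rewrite [9 * j]mulnC expnM -expnMn leq_exp2r.
have e2 : (2 ^ (2 * j + 2 * h * d + 2)) ^ 2 = 2 ^ (4 * j) * 2 ^ (4 * (h * d) + 4).
  by rewrite -expnM -expnD; congr (_ ^ _); clear; lia.
have e16 : 2 ^ (9 * j) * 2 ^ (4 * j) <= 2 ^ (16 * j).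
  by rewrite -expnD leq_exp2l //; clear; lia.
rewrite e2 /K; move: (2 ^ (4 * (h * d) + 4)) => c.
have -> : M * (2 * d * n * ((d * n) ^ 2 * (2 ^ (4 * j) * c * tot ^ 2))) * n ^ 6 =
  n ^ 9 * 2 ^ (4 * j) * (2 * M * d ^ 3 * c * tot ^ 2).
  by rewrite !expnMn !expnSr expn0; clear; lia.
apply: (@leq_trans ((16 * L) ^ 9 * 2 ^ (16 * j) * (2 * M * d ^ 3 * c * tot ^ 2))); last by clear; lia.
rewrite leq_mul2r; apply/orP; right.
apply: (@leq_trans ((16 * L) ^ 9 * 2 ^ (9 * j) * 2 ^ (4 * j))).
  by rewrite leq_mul2r h9 orbT.
by rewrite -mulnA leq_mul2l e16 orbT.
Qed.
End Estimates.

(** * Dense sets and triangles *)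

(** Arcs come in reversed pairs, exactly one of each pair increasing in [enum_rank]. *)
Lemma card_arcs_even (V : finType) (E : {set {set V}}) (S : {set V}) :
  simple_graph E -> #|arcs E S| = (#|arcs E S|./2).*2.
Proof.
move=> sE.
pose up := [set a : V * V | enum_rank a.1 < enum_rank a.2].
have sw_inj : injective (fun a : V * V => (a.2, a.1)) by move=> [? ?] [? ?] [-> ->].
suff h : #|arcs E S| = #|arcs E S :&: up|.*2 by rewrite h doubleK.
rewrite -(cardsID up) -addnn; congr (_ + _).
rewrite -(card_imset (arcs E S :&: up) sw_inj); apply: eq_card => -[a b].
apply/idP/imsetP => [|[[c e] + [-> ->]]]; rewrite !inE /=.
  move=> /andP[ab /and3P[aS bS adj]].
  exists (b, a); rewrite // !inE /= aS bS adj_sym adj /=.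
  rewrite ltn_neqAle leqNgt ab andbT; apply/eqP => eab.
  move: adj; rewrite (enum_rank_inj (val_inj eab)).
  by rewrite (negbTE (simple_adj_irr _ sE)).
by case/andP=> /and3P[-> -> adj] ce; rewrite adj_sym adj -leqNgt ltnW.
Qed.

(* [dense_const d] is the constant q of the introduction.  Edges are counted as
   ordered pairs: [dense d E S] says that S spans at least
   (d/2 - 1/q)(|S| - 1) edges, multiplied by 2q. *)
Definition dense_const d := 32 * (2 * (16 * d * 2 ^ (5 * d + 36))).

Lemma dense_const_ge d : 0 < d -> 32 <= dense_const d.
Proof. by move=> d0; rewrite /dense_const leq_pmulr // !(muln_gt0, expn_gt0) d0. Qed.

Definition dense (V : finType) d (E : {set {set V}}) (S : {set V}) :=
  d * dense_const d * (#|S| - 1) <= dense_const d * #|arcs E S| + 2 * (#|S| - 1).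

(** Density yields m >= (47/32)(k - 1). The first two conclusions feed [small_bound] with g + 1 = m
    - k, the third [large_bound]. The size 3 is excluded because for d = 3 a triangle is dense with
    m = k. *)
Lemma dense_half d q k m x : 3 <= d -> 32 <= q -> 4 <= k -> x + m.*2 = d * k ->
  d * q * (k - 1) <= q * m.*2 + 2 * (k - 1) ->
  [/\ k < m, 6 * k <= 5 * m & q * x <= d * q + 2 * k].
Proof.
move=> d3 q32; case: k => // k k4; rewrite subn1 /= => xm dm.
have h32 : 47 * k <= 32 * m.
  have q0 : 0 < q by lia.
  rewrite -(leq_pmul2l q0).
  have h1 : 3 * (q * k) <= d * (q * k) by rewrite leq_mul2r d3 orbT.
  have h2 : 32 * k <= q * k by rewrite leq_mul2r q32 orbT.
  lia.
split; [lia|lia|].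
have : q * (x + m.*2) = q * (d * k.+1) by rewrite xm.
lia.
Qed.

(** * First moments of dense sets and of triangles *)

Section Union.
Variables (V : finType) (d : nat).
Hypothesis d3 : 3 <= d.
Let n := #|V|.
Hypothesis nd : 8 * d <= n.
Let tot := #|regular_graphs V d|.
Let L := 2 ^ (5 * d + 36).
Let K := large_const d + L.

Lemma cut_graphs_le (S : {set V}) x : #|cut_graphs d S x| <= tot.
Proof. by apply: subset_leq_card; apply/subsetP => E; rewrite inE => /andP[]. Qed.

Lemma cut_graphs_switch (S : {set V}) x :
  #|cut_graphs d S x| * ((d * #|S| - x) * (d * (n - #|S|) - x - 2 * d ^ 2))
  <= #|cut_graphs d S x.+2| * (x.+1 * x.+2).
Proof.
have -> : n - #|S| = #|~: S| by rewrite /n -(cardsC S) addKn.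
exact: switching.
Qed.

(** Merges the two regimes: the summand n^2 stands for a gain of n 8^k when k is small, the summand
    8^k for a gain of n^3 when k is large. *)
Lemma dense_cut_graphs (S : {set V}) (x : nat) : 4 <= #|S| -> 2 * #|S| <= n ->
  #|[set E in regular_graphs V d | dense d E S & #|cut E S| == x]| * 'C(n, #|S|)
    * (n ^ 3 * 8 ^ #|S|)
  <= K * tot * (n ^ 2 + 8 ^ #|S|).
Proof.
move=> k4 kn; set D := [set E in _ | _].
(* A single counted graph certifies the parity of x and the density inequality, which are all the
   estimates ask for. *)
have [->|[E ED]] := set_0Vmem D; first by rewrite cards0.
move: ED; rewrite inE => /and3P[rE dE /eqP cE].
have DT : #|D| <= #|cut_graphs d S x|.
  apply: subset_leq_card; apply/subsetP => F; rewrite !inE.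
  by case/and3P=> /andP[-> ->] _ ->.
have xm := card_arcs_cut S rE; rewrite cE addnC in xm.
move: dE xm; rewrite /dense (card_arcs_even S (regular_simple rE)).
set m := #|arcs E S|./2 => dE xm.
have d_gt0 : 0 < d by apply: leq_trans d3.
have q32 := dense_const_ge d_gt0.
have [km mk qx] := dense_half d3 q32 k4 xm dE.
have d0 : 0 < d by apply: leq_trans d3.
have Tle x' := cut_graphs_le S x'.
have Tsw x' := cut_graphs_switch S x'.
move: km mk qx xm k4 kn Tle Tsw DT; clear dE; move: m (#|S|) => m k km mk qx xm k4 kn Tle Tsw DT.
have k0 : 0 < k by apply: leq_trans k4.
apply: (@leq_trans (#|cut_graphs d S x| * 'C(n, k) * (n ^ 3 * 8 ^ k))).
  by rewrite !leq_mul2r DT !orbT.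
have mE : m = k + (m - k).-1.+1 by move: km; clear; lia.
have [kL|kL] := leqP (k * L) n.
  have g5 : k <= 5 * (m - k).-1.+1 by move: km mk; clear; lia.
  rewrite mE in xm; have := small_bound Tle Tsw d0 k0 kL xm g5.
  move=> h; apply: (@leq_trans (L * tot * n ^ 2)).
    by rewrite (expnSr n 2) -mulnA mulnCA; have := leq_mul (leqnn (n ^ 2)) h; clear; lia.
  rewrite /K; clear; move: (L) (large_const d) (8 ^ k) => l c e; lia.
have := large_bound Tle Tsw d0 d3 (ltnW kL) kn nd qx.
move=> h; apply: (@leq_trans (large_const d * tot * 8 ^ k)).
  by have := leq_mul h (leqnn (8 ^ k)); clear; lia.
rewrite /K; clear; move: (L) (large_const d) (8 ^ k) => l c e; lia.
Qed.

Lemma dense_graphs (S : {set V}) : 4 <= #|S| -> 2 * #|S| <= n ->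
  #|[set E in regular_graphs V d | dense d E S]| * 'C(n, #|S|) * (n ^ 3 * 8 ^ #|S|)
  <= (d * #|S|).+1 * (K * tot * (n ^ 2 + 8 ^ #|S|)).
Proof.
move=> k4 kn.
have -> : #|[set E in regular_graphs V d | dense d E S]| =
   \sum_(x < (d * #|S|).+1) #|[set E in regular_graphs V d | dense d E S & #|cut E S| == x]|.
  rewrite -sum1_card (partition_big (fun E => inord #|cut E S| : 'I_(d * #|S|).+1) xpredT) //=.
  apply: eq_bigr => x _; rewrite -[RHS]sum1_card; apply: eq_bigl => E.
  have -> : (E \in [set F in regular_graphs V d | dense d F S]) =
    (E \in regular_graphs V d) && dense d E S by rewrite inE.
  have -> : (E \in [set F in regular_graphs V d | dense d F S & #|cut F S| == x]) =
    [&& E \in regular_graphs V d, dense d E S & #|cut E S| == x] by rewrite inE.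
  case: (boolP (E \in regular_graphs V d)) => //= rE.
  case: dense => //=; rewrite -val_eqE /= inordK // ltnS.
  by rewrite -(card_arcs_cut S rE) leq_addl.
rewrite !big_distrl /=.
apply: (@leq_trans (\sum_(x < (d * #|S|).+1) K * tot * (n ^ 2 + 8 ^ #|S|))); last first.
  by rewrite sum_nat_const card_ord.
by apply: leq_sum => x _; apply: dense_cut_graphs.
Qed.

Lemma dense_graphs_size k : 4 <= k -> 2 * k <= n ->
  (\sum_(S : {set V} | #|S| == k) #|[set E in regular_graphs V d | dense d E S]|)
     * (n ^ 3 * 8 ^ k)
  <= (d * k).+1 * (K * tot * (n ^ 2 + 8 ^ k)).
Proof.
move=> k4 kn.
have C0 : 0 < 'C(n, k) by rewrite bin_gt0; apply: leq_trans kn; rewrite leq_pmull.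
rewrite -(leq_pmul2l C0) mulnCA big_distrl /=.
apply: (@leq_trans (\sum_(S : {set V} | #|S| == k) (d * k).+1 * (K * tot * (n ^ 2 + 8 ^ k)))).
  apply: leq_sum => S /eqP Sk; rewrite -{}Sk in k4 kn *.
  have := dense_graphs k4 kn; set a := #|_|; clear; lia.
rewrite sum_nat_const; apply: eq_leq; congr (_ * _).
  by rewrite -card_draws; apply: eq_card => S; rewrite inE.
Qed.

(** [small_count] at k = 3 and g = 0: the number of triples just offsets the probability, so the
    expected number of triangles is bounded but need not vanish. *)
Lemma triangle_graphs :
  \sum_(S : {set V} | #|S| == 3) #|[set E in regular_graphs V d | #|arcs E S| == 6]|
  <= 2 ^ ((d + 3) * 3) * tot.
Proof.
have n3 : 3 <= n by apply: leq_trans nd; move: d3; clear; lia.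
have C0 : 0 < 'C(n, 3) by rewrite bin_gt0.
rewrite -(leq_pmul2l C0) big_distrr /=.
apply: (@leq_trans (\sum_(S : {set V} | #|S| == 3) 2 ^ ((d + 3) * 3) * tot)); last first.
  rewrite sum_nat_const; apply: eq_leq; congr (_ * _).
  by rewrite -card_draws; apply: eq_card => S; rewrite inE.
apply: leq_sum => S /eqP S3.
have d0 : 0 < d by apply: leq_trans d3.
have Tle x' := cut_graphs_le S x'.
have Tsw x' := cut_graphs_switch S x'.
rewrite S3 in Tsw.
have xm : d * 3 - 6 + (3 + 0).*2 = d * 3 by move: d3; clear; lia.
have n4 : 4 * (3 + d) <= n by apply: leq_trans nd; move: d3; clear; lia.
have := small_count Tle Tsw d0 (isT : 0 < 3) n4 xm.
rewrite !expn0 !muln1 [_ * tot]mulnC; apply: leq_trans.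
rewrite mulnC leq_mul2r; apply/orP; right.
apply: subset_leq_card; apply/subsetP => E; rewrite inE => /andP[rE /eqP aE].
by rewrite inE rE; have := card_arcs_cut S rE; rewrite aE S3 => <-; rewrite addKn eqxx.
Qed.
End Union.

(** * Spanning trees and components *)

Section Forests.
Variable V : finType.
Implicit Types (E F H T : {set {set V}}) (S C : {set V}) (x y z : V).

Lemma connect_adj_sym H : connect_sym (adj_rel H).
Proof. exact: sym_connect_sym (@adj_sym V H). Qed.

Lemma connect_adjS F H x y : F \subset H ->
  connect (adj_rel F) x y -> connect (adj_rel H) x y.
Proof.
move=> FH; apply: (@connect_sub V (adj_rel F) (adj_rel H)) => u v uv.
by apply: connect1; rewrite /adj_rel (subsetP FH).
Qed.

(** The rest of the cycle leads from y back to x: its first edge yz is not xy because z differs from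
    x, and the later ones avoid y. *)
Lemma cycle_bypass H x y z s : ucycle (adj_rel H) [:: x, y, z & s] ->
  connect (adj_rel (H :\ [set x; y])) x y.
Proof.
case/andP=> /= /and3P[xy yz pth] /and4P[xN yN zN sN].
rewrite connect_adj_sym; apply/connectP; exists (z :: rcons s x); last by rewrite /= last_rcons.
have [xz [ys yNz]] : x != z /\ (y \notin s /\ y != z).
  by move: xN yN; rewrite !inE !negb_or => /and3P[_ ? _] /andP[].
have xNy : x != y by move: xN; rewrite !inE negb_or => /andP[].
rewrite /=; apply/andP; split.
  rewrite /adj_rel !inE doubleton_eq negb_or !negb_and ![_ == x]eq_sym xNy xz orbT /=.
  exact: yz.
have : y \notin z :: rcons s x by rewrite inE mem_rcons inE !negb_or yNz ys eq_sym xNy.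
elim: (rcons s x) z pth {xN yN zN yz xz yNz} => //= w t IH z /andP[zw pth].
rewrite !inE !negb_or => /and3P[yz yw yt].
rewrite {1}/adj_rel !inE (zw : [set z; w] \in H) andbT doubleton_eq negb_or !negb_and.
by rewrite ![_ == y]eq_sym yz yw orbT /= IH // inE negb_or yw yt.
Qed.

Lemma connect_delete H x y : connect (adj_rel (H :\ [set x; y])) x y ->
  connect (adj_rel (H :\ [set x; y])) =2 connect (adj_rel H).
Proof.
move=> xy u v; apply/idP/idP; first exact/connect_adjS/subsetDl.
apply: (@connect_sub V (adj_rel H)) => a b ab.
have [e|ne] := eqVneq [set a; b] [set x; y]; last first.
  by apply: connect1; rewrite /adj_rel !inE ne.
move/eqP: e; rewrite doubleton_eq => /orP[]/andP[/eqP-> /eqP->] //.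
by rewrite connect_adj_sym.
Qed.

Lemma connect_delete_cases H u v x y : connect (adj_rel H) x y ->
  let c := connect (adj_rel (H :\ [set u; v])) in
  [\/ c x y, c x u && c v y | c x v && c u y].
Proof.
move=> + c; move=> /connectP[p pth ->{y}].
elim: p x pth => [|w p IH] x /=; first by move=> _; apply: Or31; apply: connect0.
move=> /andP[xw /IH{}IH].
have [e|ne] := eqVneq [set x; w] [set u; v].
  move/eqP: e; rewrite doubleton_eq => /orP[]/andP[/eqP ex /eqP ew]; subst x w.
    case: IH => [h|/andP[_ h]|/andP[_ h]]; [|by apply: Or32; rewrite /c connect0|by apply: Or31].
    by apply: Or32; rewrite /c connect0.
  case: IH => [h|/andP[_ h]|/andP[_ h]]; [|by apply: Or31|by apply: Or33; rewrite /c connect0].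
  by apply: Or33; rewrite /c connect0.
have xw' : c x w by apply: connect1; rewrite /adj_rel !inE ne.
case: IH => [h|/andP[h1 h2]|/andP[h1 h2]].
- exact/Or31/(connect_trans xw').
- by apply: Or32; rewrite h2 andbT; apply: connect_trans h1.
- by apply: Or33; rewrite h2 andbT; apply: connect_trans h1.
Qed.

Definition components H := equivalence_partition (connect (adj_rel H)) [set: V].

Lemma components_partition H : partition (components H) [set: V].
Proof.
apply: equivalence_partitionP => x y z _ _ _; split; first exact: connect0.
by move=> xy; apply: same_connect => //; apply: connect_adj_sym.
Qed.

Definition component H x := [set y | connect (adj_rel H) x y].

Lemma componentsE H : components H = [set component H x | x : V].
Proof.
by apply/setP => C; apply/imsetP/imsetP => -[x _ ->]; exists x => //;
  apply/setP => y; rewrite !inE.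
Qed.

Lemma component_eq H x y : (component H x == component H y) = connect (adj_rel H) x y.
Proof.
apply/eqP/idP => [e|xy].
  have : y \in component H y by rewrite inE connect0.
  by rewrite -e inE.
by apply/setP => z; rewrite !inE; apply: same_connect => //; apply: connect_adj_sym.
Qed.

(** Sending a component to the component of [H] containing it is injective away from the component
    of u, since only those of u and v can merge. *)
Lemma components_delete H u v :
  #|components (H :\ [set u; v])| <= #|components H|.+1.
Proof.
set H' := H :\ [set u; v].
rewrite (cardsD1 (component H' u)).
apply: (@leq_add _ _ 1 #|components H|); first by case: (_ \in _).
pose f C : {set V} := \bigcup_(x in C) component H x.
have fE x : f (component H' x) = component H x.
  apply/setP => z; apply/bigcupP/idP => [[y]|xz].
    rewrite !inE => xy; apply: connect_trans; apply: connect_adjS xy; exact: subsetDl.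
  by exists x => //; rewrite inE connect0.
rewrite -(card_in_imset (_ : {in components H' :\ component H' u &, injective f})).
  apply: subset_leq_card; apply/subsetP => _ /imsetP[C + ->].
  rewrite !inE componentsE => /andP[_ /imsetP[x _ ->]].
  by rewrite fE componentsE imset_f.
move=> C D /setD1P[nC CI] /setD1P[nD DI]; move: CI DI nC nD.
rewrite componentsE => /imsetP[x _ ->] /imsetP[y _ ->] nx ny.
rewrite !fE => /eqP; rewrite component_eq => xy; apply/eqP.
rewrite !component_eq in nx ny *.
case: (connect_delete_cases u v xy) => [//|/andP[xu _]|/andP[_ uy]].
  by rewrite xu in nx.
by rewrite connect_adj_sym uy in ny.
Qed.

(** Induction on edges: without edges every vertex is a component, and deleting an edge adds at most
    one component. *)
Lemma card_le_components H : simple_graph H -> #|V| <= #|H| + #|components H|.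
Proof.
move: {2}#|H| (leqnn #|H|) => m; elim: m H => [|m IH] H Hm sH.
  move: Hm; rewrite leqn0 cards_eq0 => /eqP H0.
  rewrite H0 cards0 add0n componentsE card_imset // => x y /eqP.
  rewrite component_eq => /connectP[[|z p] /= + ->] //.
  by rewrite /adj_rel inE.
have [H0|[e eH]] := set_0Vmem H; first by apply: IH => //; rewrite H0 cards0.
have /cards2P[u [v [uv eE]]] := forall_inP sH _ eH; subst e.
have sH' : simple_graph (H :\ [set u; v]).
  by apply/forall_inP => e /setD1P[_ /(forall_inP sH)].
have cH := cardsD1 [set u; v] H; rewrite eH add1n in cH.
have := IH _ _ sH'; rewrite -ltnS -cH => /(_ Hm) h.
by apply: leq_trans h _; rewrite cH addSnnS leq_add2l components_delete.
Qed.

Lemma spanning_tree_forest E H : simple_graph E -> connected_graph E -> H \subset E ->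
  exists T, spanning_tree E T /\ #|V| <= #|T :&: H| + #|components H|.
Proof.
move=> sE cE HE.
(* F is a minimal subgraph of H with the same components, T a minimal connected
   subgraph of E containing F: a cycle of T must lie in F, and F has none. *)
pose same F := [forall x, forall y, connect (adj_rel F) x y == connect (adj_rel H) x y].
have same_E F : same F -> connect (adj_rel F) =2 connect (adj_rel H).
  by move=> sF x y; apply/eqP; move/forallP: sF => /(_ x)/forallP/(_ y).
have [F /minsetP[/andP[FH sF] minF] _] : {F | minset (fun F => (F \subset H) && same F) F & F \subset H}.
  apply: minset_exists; rewrite subxx /=; by apply/forallP => x; apply/forallP.
have FE := subset_trans FH HE.
have [T /minsetP[/and3P[FT TE cT] minT] _] :
    {T | minset (fun T => [&& F \subset T, T \subset E & connected_graph T]) T & T \subset E}.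
  by apply: minset_exists; rewrite FE subxx.
exists T; split; last first.
  have -> : components H = components F.
    by rewrite !componentsE; apply: eq_imset => x; apply/setP => y; rewrite !inE same_E.
  have sFs : simple_graph F.
    by apply/forall_inP => e eF; apply: (forall_inP sE); apply: subsetP eF.
  apply: leq_trans (card_le_components sFs) _; rewrite leq_add2r.
  by apply: subset_leq_card; rewrite subsetI FT FH.
split=> // c c3 cyc.
have next_F x : x \in c -> [set x; next c x] \in F.
  (* Rotating the cycle to start at x puts the edge to [next c x] first, the shape [cycle_bypass]
     expects. *)
  move=> xc; case/rot_to: (xc) => i c' rc.
  have cyc' : ucycle (adj_rel T) (rot i c) by rewrite rot_ucycle.
  have /andP[_ uc] := cyc.
  have nx : next (rot i c) x = next c x by apply: next_rot.
  have : 3 <= size (rot i c) by rewrite size_rot.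
  rewrite rc in cyc' nx *; case: c' cyc' nx {rc} => [|y [|z s]] //= cyc'.
  rewrite eqxx => <- _.
  apply: contraTT (isT) => xyF.
  have byp := cycle_bypass cyc'.
  have TD : T :\ [set x; y] = T.
    apply: minT; last exact: subsetDl.
    rewrite subsetD1 FT xyF (subset_trans (subsetDl _ _) TE) /=.
    have /andP[V0 /forallP cTT] := cT; rewrite /connected_graph V0 /=.
    apply/forallP => a; apply/forallP => b; rewrite connect_delete //.
    by move/forallP: (cTT a).
  have /andP[/= /andP[xyT _] _] := cyc'.
  by move: (xyT : [set x; y] \in T); rewrite -TD !inE eqxx.
have /andP[_ uc] := cyc.
have cycF : ucycle (adj_rel F) c.
  rewrite /ucycle uc andbT; apply: cycle_from_next => // x xc; exact: next_F.
case: c c3 cycF {cyc next_F uc} => [|x [|y [|z s]]] // _ cycF.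
have byp := cycle_bypass cycF.
have FD : F :\ [set x; y] = F.
  apply: minF; last exact: subsetDl.
  rewrite (subset_trans (subsetDl _ _) FH) /=.
  by apply/forallP => a; apply/forallP => b; rewrite connect_delete // same_E.
have /andP[/= /andP[xyF _] _] := cycF.
by move: (xyF : [set x; y] \in F); rewrite -FD !inE eqxx.
Qed.

End Forests.

(** * Regular graphs without dense sets *)

Section NoDense.
Variables (V : finType) (d : nat) (E : {set {set V}}).
Hypotheses (d3 : 3 <= d) (rE : E \in regular_graphs V d).
Hypothesis no_dense : forall S : {set V}, 4 <= #|S| -> 2 * #|S| <= #|V| -> ~~ dense d E S.
Let q := dense_const d.

Lemma card_arcs_le (S : {set V}) : #|arcs E S| <= #|S| * (#|S| - 1).
Proof.
rewrite -sum_nat_const.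
apply: (@leq_trans (\sum_(x in S) #|[set y | (y \in S) && adj_rel E x y]|)).
  rewrite -(card_fibred (mem S) (fun x y => (y \in S) && adj_rel E x y)).
  by apply: subset_leq_card; apply/subsetP => a; rewrite !inE.
apply: leq_sum => x xS; rewrite subn1.
have -> : #|S|.-1 = #|S :\ x| by rewrite [#|S|](cardsD1 x) xS.
apply: subset_leq_card; apply/subsetP => y; rewrite !inE => /andP[yS xy].
rewrite yS andbT; apply: contraTneq xy => ->.
exact: simple_adj_irr (regular_simple rE).
Qed.

Lemma component_cut x : #|cut E (component E x)| = 0.
Proof.
apply/eqP; rewrite cards_eq0 -subset0; apply/subsetP => -[a b].
rewrite !inE /= => /and3P[xa /negP xb ab]; case: xb.
exact: connect_trans xa (connect1 ab).
Qed.

(** A component has no cut, so it spans d|C| arcs: with 4 to n/2 vertices it would be dense, with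
    fewer than 4 it has no room for degree d >= 3. So each component exceeds n/2, and any two
    meet. *)
Lemma connected_of_no_dense : 0 < #|V| -> connected_graph E.
Proof.
move=> V0; rewrite /connected_graph V0 /=.
have big x : #|V| < 2 * #|component E x|.
  rewrite ltnNge; apply/negP => small.
  have := card_arcs_cut (component E x) rE; rewrite component_cut addn0.
  have := card_arcs_le (component E x).
  have : 0 < #|component E x|.
    by rewrite card_gt0; apply/set0Pn; exists x; rewrite inE connect0.
  have [k4|k4] := leqP 4 #|component E x|.
    have := no_dense k4 small; rewrite /dense => /negP h _ _ aE; apply: h.
    rewrite aE mulnCA mulnA; apply: leq_trans (leq_addr _ _).
    by rewrite leq_mul2l leq_subr orbT.
  move=> k0 h1 h2; rewrite h2 mulnC leq_mul2l in h1.
  by move: h1 k4 k0 d3; clear; lia.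
apply/forallP => x; apply/forallP => y; rewrite -component_eq.
apply/negPn/negP => nxy.
have dis : [disjoint component E x & component E y].
  apply/pred0P => z /=; apply/negP => /andP[]; rewrite !inE => xz yz.
  move: nxy; rewrite component_eq (connect_trans xz) //.
  by rewrite connect_adj_sym.
have := max_card (component E x :|: component E y).
rewrite cardsU (disjoint_setI0 dis) cards0 subn0.
have := big x; have := big y; clear; lia.
Qed.

Definition triangle (S : {set V}) := (#|S| == 3) && (#|arcs E S| == 6).

(** Up to size n/2 this is the absence of dense sets, beyond it the same for the complement; below
    size 4 only a triangle exceeds the main term. *)
Lemma arcs_bound (S : {set V}) : 16 <= #|V| -> 0 < #|S| -> 16 * (#|S| - 1) < 9 * #|V| ->
  q * #|arcs E S| <= (d * q - 1) * (#|S| - 1) + 6 * q * triangle S.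
Proof.
move=> n16 k0 kn.
have q2 : 2 <= q.
  by apply: (@leq_trans 32) => //; apply: dense_const_ge; apply: leq_trans d3.
have dq : 3 * q <= d * q by rewrite leq_mul2r d3 orbT.
have le := card_arcs_le S.
have [k4|k4] := ltnP #|S| 4.
  have h1 : #|S| = 1 \/ #|S| = 2 \/ #|S| = 3 by move: k0 k4; clear; lia.
  rewrite /triangle; move: le; case: h1 => [->|[->|->]] /=.
  - by rewrite leqn0 => /eqP ->; rewrite muln0.
  - rewrite muln0 addn0 !muln1 => le; have := leq_mul (leqnn q) le; move: dq q2; clear; lia.
  - rewrite leq_eqVlt => /orP[/eqP->|h]; first by rewrite /= muln1; clear; lia.
    rewrite ltn_eqF // muln0 addn0.
    have h' : #|arcs E S| <= 5 by rewrite -ltnS.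
    have := leq_mul (leqnn q) h'; have := leq_sub2r 1 dq.
    rewrite (_ : 3 - 1 = 2) //; move: q2; move: (d * q - 1) #|arcs E S| q => t a p; clear; lia.
apply: leq_trans (leq_addr _ _).
have [kn2|kn2] := leqP (2 * #|S|) #|V|.
  have := no_dense k4 kn2; rewrite /dense -ltnNge -/q mulnBl mul1n.
  by move: (d * q * _) => a; clear; lia.
(* With c = n - |S|, the complement not being dense forces a cut above d + 2(c - 1)/q, hence fewer
   than d(|S| - 1) - 2(c - 1)/q arcs in [S]; then |S| - 1 <= 2(c - 1) is used. *)
have cS := cardsC S.
have c4 : 4 <= #|~: S| by move: cS kn n16; clear; lia.
have c2 : 2 * #|~: S| <= #|V| by move: cS kn2; clear; lia.
have := no_dense c4 c2; rewrite /dense -ltnNge -/q.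
have := card_arcs_cut (~: S) rE; rewrite card_cutC; have := card_arcs_cut S rE.
have : #|S| - 1 <= 2 * (#|~: S| - 1) by move: cS kn n16; clear; lia.
move: kn kn2 cS c4 k0; move: #|arcs E S| #|arcs E (~: S)| #|cut E S| #|S| #|~: S|.
move=> a b x k c kn kn2 cS c4 k0 kc ak bc h.
rewrite mulnBl mul1n.
have e1 : q * (a + x) = q * (d * k) by rewrite ak.
have e2 : q * (b + x) = q * (d * c) by rewrite bc.
case: k k0 kc ak e1 cS kn kn2 => // k _ kc ak e1 cS kn kn2.
case: c c4 bc e2 h cS kc => // c c4 bc e2 h cS kc.
rewrite !subn1 /= in kc h *.
move: e1 e2 h kc; clear; lia.
Qed.

Lemma card_components_sum (H : {set {set V}}) : #|V| = \sum_(C in components H) #|C|.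
Proof. by rewrite -(card_partition (components_partition H)) cardsT. Qed.

Lemma component_card_gt0 (H : {set {set V}}) C : C \in components H -> 0 < #|C|.
Proof.
rewrite componentsE => /imsetP[x _ ->].
by rewrite card_gt0; apply/set0Pn; exists x; rewrite inE connect0.
Qed.

Lemma sum_card_pred (H : {set {set V}}) :
  #|components H| + \sum_(C in components H) (#|C| - 1) = #|V|.
Proof.
rewrite [RHS](card_components_sum H) -sum1_card -big_split /=.
by apply: eq_bigr => C /component_card_gt0 C0; rewrite subnKC.
Qed.

Lemma card_arcs_components (H : {set {set V}}) :
  #|arcs H setT| <= \sum_(C in components H) #|arcs H C|.
Proof.
have -> : arcs H setT = \bigcup_(C in components H) arcs H C.
  apply/setP => -[a b]; apply/idP/bigcupP => [|[C _]]; rewrite !inE //=; last by case/and3P.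
  move=> ab; exists (component H a); first by rewrite componentsE imset_f.
  by rewrite !inE connect0 (connect1 ab).
apply: (big_ind2 (fun (A : {set V * V}) m => #|A| <= m)); first by rewrite cards0.
  by move=> A m B m' h h'; apply: leq_trans (leq_card_setU _ _) (leq_add h h').
by [].
Qed.

Variable r : nat.
Variable H : 'I_r -> {set {set V}}.
Hypotheses (r2 : 2 <= r) (HE : forall i, H i \subset E).
Hypothesis H_cover : forall e, e \in E -> exists i, e \in H i.
Hypothesis n16 : 16 <= #|V|.
Hypothesis few_triangles : 12 * q * r * #|[set S : {set V} | triangle S]| < #|V|.

(** By contradiction: if every rank [rho i] is below (1 + 1/M) n/r with M = 2dq, then [arcs_bound]
    applies to all components, and the colours together cover too few arcs. *)
Lemma large_rank : exists i : 'I_r,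
  (2 * (d * q)).+1 * #|V| + r * (2 * (d * q)) * #|components (H i)| <= r * (2 * (d * q)) * #|V|.
Proof.
apply/existsP; apply: contraT => /existsPn no.
have q1 : 8 <= d * q.
  apply: (@leq_trans (3 * 32)) => //; apply: leq_mul => //.
  by apply: dense_const_ge; apply: leq_trans d3.
pose rho i := \sum_(C in components (H i)) (#|C| - 1).
have rhoE i := sum_card_pred (H i).
set M := 2 * (d * q) in no.
have rho_lt i : r * M * rho i < M.+1 * #|V|.
  have := no i; rewrite -ltnNge.
  have -> : r * M * #|V| = r * M * #|components (H i)| + r * M * rho i.
    by rewrite -mulnDr rhoE.
  by rewrite addnC ltn_add2r.
have block i C : C \in components (H i) ->
    q * #|arcs (H i) C| <= (d * q - 1) * (#|C| - 1) + 6 * q * triangle C.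
  move=> CH; have C0 := component_card_gt0 CH.
  apply: (@leq_trans (q * #|arcs E C|)).
    rewrite leq_mul2l; apply/orP; right; apply: subset_leq_card; apply/subsetP => a.
    by rewrite !inE => /and3P[-> ->]; apply: (subsetP (HE i)).
  apply: arcs_bound => //.
  (* A component has |C| - 1 <= rho_i < (1 + 1/M) n/2, and 1 + 1/M <= 9/8 gives the 9n/16 of
     [arcs_bound]. *)
  have Crho : #|C| - 1 <= rho i by rewrite /rho (bigD1 C) //= leq_addr.
  have h1 : 2 * M * (#|C| - 1) < M.+1 * #|V|.
    apply: leq_ltn_trans (rho_lt i); apply: leq_mul => //; by rewrite leq_mul2r r2 orbT.
  have h2 : 8 * M.+1 <= 9 * M by rewrite /M; move: q1; clear; lia.
  have M0 : 0 < M by rewrite /M; move: q1; clear; lia.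
  rewrite -(ltn_pmul2l M0).
  have := leq_mul h2 (leqnn #|V|); move: h1; clear; lia.
have tot : q * (d * #|V|) <= \sum_i q * #|arcs (H i) setT|.
  rewrite -[#|V|]cardsT -(card_arcs_cut setT rE).
  have -> : cut E setT = set0 by apply/setP => a; rewrite !inE.
  rewrite cards0 addn0 -big_distrr leq_mul2l /=; apply/orP; right.
  have sub : arcs E setT \subset \bigcup_i arcs (H i) setT.
    apply/subsetP => a; rewrite !inE /= => /H_cover[i ai].
    by apply/bigcupP; exists i => //; rewrite !inE.
  apply: leq_trans (subset_leq_card sub) _.
  apply: (big_ind2 (fun (A : {set V * V}) m => #|A| <= m)); first by rewrite cards0.
    by move=> A m B m' h h'; apply: leq_trans (leq_card_setU _ _) (leq_add h h').
  by [].
have few := few_triangles; set Z := #|_| in few.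
have colour i : q * #|arcs (H i) setT| <= (d * q - 1) * rho i + 6 * q * Z.
  apply: (@leq_trans (\sum_(C in components (H i)) q * #|arcs (H i) C|)).
    by rewrite -big_distrr leq_mul2l card_arcs_components orbT.
  apply: (@leq_trans (\sum_(C in components (H i))
      ((d * q - 1) * (#|C| - 1) + 6 * q * triangle C))).
    by apply: leq_sum => C; apply: block.
  rewrite big_split -!big_distrr /= leq_add2l leq_mul2l; apply/orP; right.
  rewrite /Z -sum1dep_card big_mkcond [X in _ <= X]big_mkcond /=.
  by apply: leq_sum => C _; case: ifP => // _; case: triangle.
have sum1 : q * (d * #|V|) <= (d * q - 1) * (\sum_i rho i) + r * (6 * q * Z).
  apply: leq_trans tot _; apply: (@leq_trans (\sum_i ((d * q - 1) * rho i + 6 * q * Z))).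
    by apply: leq_sum => i _; apply: colour.
  by rewrite big_split /= -big_distrr sum_nat_const card_ord.
have sum2 : M * (\sum_i rho i) <= M.+1 * #|V|.
  have r0 : 0 < r by apply: leq_trans r2.
  rewrite -(leq_pmul2l r0) mulnA big_distrr /=.
  apply: (@leq_trans (\sum_(i < r) M.+1 * #|V|)); last by rewrite sum_nat_const card_ord.
  by apply: leq_sum => i _; apply: ltnW.
have := leq_mul (leqnn M) sum1.
have h3 := leq_mul (leqnn (d * q - 1)) sum2.
(* As M = 2dq, (dq - 1)(1 + 1/M) = dq - (dq + 1)/M: more than n/2 is missing, while the triangles
   supply less than n/2. *)
have e1 : (d * q - 1) * M.+1 + d * q + 1 = M * (d * q).
  rewrite /M; move: q1; move: (d * q) => t; case: t => // t _; rewrite subn1 /=; clear; lia.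
have e2 : M * (q * (d * #|V|)) = ((d * q - 1) * M.+1 + d * q + 1) * #|V|.
  by rewrite e1; clear; lia.
rewrite e2 => h4.
have h5 : (d * q + 1) * #|V| <= M * (r * (6 * q * Z)).
  move: h3 h4; move: (\sum_i _) (d * q - 1) => s t; clear; lia.
have h6 : d * q * #|V| <= d * q * (12 * q * r * Z).
  by move: h5; rewrite /M; clear; lia.
move: h6; rewrite leq_mul2l leqNgt few orbF; move: q1; clear; lia.
Qed.
End NoDense.

(** * Existence of regular graphs *)

Section Cayley.
Import GRing.Theory.
Local Open Scope ring_scope.
Variables (N : nat) (D : {set 'I_N.+1}).
Hypotheses (D0 : 0 \notin D) (DN : forall z, z \in D -> - z \in D).

Definition cayley_graph : {set {set 'I_N.+1}} :=
  [set [set p.1; p.2] | p : 'I_N.+1 * 'I_N.+1 & p.2 - p.1 \in D].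

Lemma cayley_adj u v : adj_rel cayley_graph u v = (v - u \in D).
Proof.
apply/imsetP/idP => [[[a b]]|uv]; last by exists (u, v); rewrite ?inE.
rewrite inE /= => ab /eqP; rewrite doubleton_eq => /orP[]/andP[/eqP-> /eqP->] //.
by rewrite -opprB DN.
Qed.

Lemma cayley_regular : cayley_graph \in regular_graphs 'I_N.+1 #|D|.
Proof.
rewrite inE; apply/andP; split.
  apply/forall_inP => e /imsetP[[a b]]; rewrite inE /= => ab ->.
  have ne : a != b by apply: contraNneq D0 => eab; move: ab; rewrite eab subrr.
  by rewrite cards2 ne.
apply/forallP => v; rewrite /degree -[X in _ == X](card_imset _ (addIr v)).
apply/eqP; apply: eq_card => u; rewrite inE cayley_adj.
apply/idP/imsetP => [uv|[z zD ->]]; last by rewrite addrK.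
by exists (u - v); rewrite ?subrK.
Qed.
End Cayley.

(** Takes 1, ..., floor(d/2) and their negatives; for odd d, when N + 1 is even, also (N + 1)/2,
    which is its own negative. The bound on d keeps these disjoint and away from 0. *)
Lemma symmetric_set N d : (d < N)%N -> ~~ odd (d * N.+1) ->
  exists D : {set 'I_N.+1}, [/\ (0 \notin D)%R,
    forall z, z \in D -> (- z \in D)%R & #|D| = d].
Proof.
move=> dN ev.
pose j := d./2; have jd := odd_double_half d; rewrite -/j in jd.
pose A : {set 'I_N.+1} := [set z : 'I_N.+1 | 0 < z <= j].
have cA : #|A| = j.
  pose f (i : 'I_j) : 'I_N.+1 := inord i.+1.
  have fE i : val (f i) = i.+1.
    by rewrite /f /= inordK //; have := ltn_ord i; move: dN jd; clear; lia.
  have finj : injective f.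
    by move=> i i' /(congr1 val); rewrite !fE => -[] /val_inj.
  rewrite -[RHS]card_ord -(card_imset _ finj); apply: eq_card => z.
  rewrite inE; apply/idP/imsetP => [/andP[z0 zj]|[i _ ->]]; last first.
    by have := fE i; rewrite /= => ->; rewrite ltn_ord.
  have zj' : z.-1 < j by move: z0 zj; clear; lia.
  by exists (Ordinal zj') => //; apply: val_inj; rewrite fE /= prednK.
pose B : {set 'I_N.+1} := [set (- z)%R | z in A].
have cB : #|B| = j by rewrite card_imset //; apply: GRing.oppr_inj.
pose c : 'I_N.+1 := inord N.+1./2.
pose C : {set 'I_N.+1} := if odd d then [set c] else set0.
have cC : #|C| = odd d by rewrite /C; case: odd; rewrite ?cards1 ?cards0.
have opp_val (z : 'I_N.+1) : 0 < z -> val (- z)%R = N.+1 - z.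
  move=> z0 /=; rewrite modn_small //; have := ltn_ord z; move: z0; clear; lia.
have AP z : z \in A -> 0 < z <= j by rewrite inE.
have BP z : z \in B -> N.+1 - j <= z.
  move=> /imsetP[a /AP/andP[a0 aj] ->]; have := opp_val _ a0.
  move=> /= ->; move: aj; clear; lia.
have CP z : z \in C -> odd d /\ z.*2 = N.+1.
  rewrite /C; case od: (odd d); rewrite ?inE // => /eqP->.
  have evN : ~~ odd N.+1 by move: ev; rewrite oddM od.
  by split=> //; rewrite /c inordK ?even_halfK //; clear; lia.
exists (A :|: B :|: C); split.
- rewrite !inE /= !negb_or; apply/andP; split; last first.
    by apply/negP => /CP[_].
  by apply/negP => /BP /=; move: dN jd; clear; lia.
- move=> z; rewrite !inE -!orbA => /or3P[zA|zB|zC].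
  + by apply/orP; right; apply/orP; left; apply: imset_f; rewrite inE.
  + by case/imsetP: zB => a; rewrite inE => aA ->; rewrite GRing.opprK aA.
  + suff -> : (- z)%R = z by rewrite zC !orbT.
    have [_ z2] := CP _ zC.
    have z0 : 0 < z by rewrite -double_gt0 z2.
    apply: val_inj; rewrite opp_val //=; move: z2; clear; lia.
rewrite !cardsU cA cB cC.
have -> : A :&: B = set0.
  apply/setP => z; rewrite in_setI in_set0; apply/negP => /andP[/AP za /BP zb].
  by move: za zb dN jd; clear; lia.
have -> : (A :|: B) :&: C = set0.
  apply/setP => z; rewrite in_setI in_setU in_set0.
  apply/negP => /andP[/orP[/AP za|/BP zb] /CP[od z2]].
    by move: za z2 dN jd; rewrite od; clear; lia.
  by move: zb z2 dN jd; rewrite od; clear; lia.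
by rewrite cards0 !subn0 addnn addnC.
Qed.

(** Needed for the limit because [uniform_probability] is 0 on an empty sample space. *)
Lemma regular_graphs_gt0 n d : d.+2 <= n -> ~~ odd (d * n) -> 0 < #|regular_graphs 'I_n d|.
Proof.
case: n => // N dN ev; have [D [D0 DN <-]] := @symmetric_set N d dN ev.
by rewrite card_gt0; apply/set0Pn; exists (cayley_graph D); apply: cayley_regular.
Qed.

(** * Good random regular graphs *)

Lemma sum_pow2 n : \sum_(k < n.+1) 2 ^ (n - k) < 2 ^ n.+1.
Proof.
elim: n => [|n IH]; first by rewrite big_ord1.
rewrite big_ord_recl subn0 [2 ^ n.+2]expnS mul2n -addnn ltn_add2l.
by under eq_bigr => i _ do rewrite subSS.
Qed.

Section Bad.
Variables (V : finType) (d : nat).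
Hypothesis d3 : 3 <= d.
Let n := #|V|.
Hypothesis nd : 8 * d <= n.
Let tot := #|regular_graphs V d|.
Let K := large_const d + 2 ^ (5 * d + 36).

Definition has_dense (E : {set {set V}}) :=
  [exists S : {set V}, [&& 4 <= #|S|, 2 * #|S| <= n & dense d E S]].

(** A dense set of size k exists with probability at most a constant times k (8^-k / n + n^-3), and
    summing over k <= n gives O(1/n). *)
Lemma has_dense_count : #|[set E in regular_graphs V d | has_dense E]| * n <= 6 * (d.+1 * K) * tot.
Proof.
pose D k := \sum_(S : {set V} | #|S| == k) #|[set E in regular_graphs V d | dense d E S]|.
have n0 : 0 < n by apply: leq_trans nd; move: d3; clear; lia.
pose P k := (4 <= k) && (2 * k <= n).
have cover : #|[set E in regular_graphs V d | has_dense E]| <= \sum_(k < n.+1 | P k) D k.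
  apply: (@leq_trans (\sum_(S : {set V} | P #|S|) #|[set E in regular_graphs V d | dense d E S]|)).
    apply: (@leq_trans #|\bigcup_(S : {set V} | P #|S|) [set E in regular_graphs V d | dense d E S]|).
      apply: subset_leq_card; apply/subsetP => E.
      rewrite inE => /andP[rE /existsP[S /and3P[S4 Sn dE]]].
      by apply/bigcupP; exists S; rewrite ?inE ?rE /P ?S4 //; move: rE; rewrite inE => ->.
    apply: (big_ind2 (fun (A : {set {set {set V}}}) m => #|A| <= m)); first by rewrite cards0.
      by move=> A m B m' h h'; apply: leq_trans (leq_card_setU _ _) (leq_add h h').
    by [].
  rewrite (partition_big (fun S : {set V} => inord #|S| : 'I_n.+1) (fun k => P k)) /=.
    apply: leq_sum => k Pk; rewrite /D big_mkcond [X in _ <= X]big_mkcond /=.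
    apply: leq_sum => S _; case: ifP => // /andP[_ /eqP <-].
    by rewrite inordK ?eqxx // ltnS max_card.
  by move=> S; rewrite inordK // ltnS max_card.
(* The factor 2^n keeps 2^-k integral, and k + 1 <= 4^k reduces (dk + 1) 8^-k to (d + 1) 2^-k. *)
have term k : P k -> k <= n -> D k * (n ^ 3 * 2 ^ n) <=
    d.+1 * K * tot * (n ^ 2 * 2 ^ (n - k) + n.+1 * 2 ^ n).
  move=> /andP[k4 k2] kn; have := dense_graphs_size d3 nd k4 k2; rewrite -/n -/K -/tot -/(D k).
  have e8 : 8 ^ k = 2 ^ k * 4 ^ k by rewrite -expnMn.
  have e2 : 2 ^ n = 2 ^ k * 2 ^ (n - k) by rewrite -expnD subnKC.
  have k4' : k.+1 <= 4 ^ k by apply: ltn_expl.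
  have p4 : 0 < 4 ^ k by rewrite expn_gt0.
  have p2 : 0 < 2 ^ (n - k) by rewrite expn_gt0.
  have dk : (d * k).+1 <= d.+1 * k.+1 by clear; lia.
  rewrite e8 e2; move: (2 ^ k) (4 ^ k) (2 ^ (n - k)) k4' p4 p2 => x y z k4' p4 p2 h.
  rewrite -(leq_pmul2r p4).
  apply: (@leq_trans ((d * k).+1 * (K * tot * (n ^ 2 + x * y)) * z)).
    by have := leq_mul h (leqnn z); move: (D k) (n ^ 3) (n ^ 2) K => a b c g; clear; lia.
  apply: (@leq_trans (d.+1 * k.+1 * (K * tot * (n ^ 2 + x * y)) * z)).
    by rewrite leq_mul2r leq_mul2r dk !orbT.
  have h1 : k.+1 * (n ^ 2 * z) <= y * (n ^ 2 * z) by rewrite leq_mul2r k4' orbT.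
  have h2 : k.+1 * (x * y * z) <= n.+1 * (x * y * z) by rewrite leq_mul2r ltnS kn orbT.
  have := leq_mul (leqnn (d.+1 * K * tot)) (leq_add h1 h2).
  move: (n ^ 2) K => c g; clear; lia.
have total : #|[set E in regular_graphs V d | has_dense E]| * (n ^ 3 * 2 ^ n) <=
    d.+1 * K * tot * (6 * n ^ 2 * 2 ^ n).
  apply: (@leq_trans (\sum_(k < n.+1 | P k) d.+1 * K * tot * (n ^ 2 * 2 ^ (n - k) + n.+1 * 2 ^ n))).
    apply: (@leq_trans ((\sum_(k < n.+1 | P k) D k) * (n ^ 3 * 2 ^ n))).
      by rewrite leq_mul2r cover orbT.
    rewrite big_distrl /=; apply: leq_sum => k Pk; apply: term => //.
    by rewrite -ltnS.
  rewrite -big_distrr leq_mul2l /=; apply/orP; right.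
  apply: (@leq_trans (\sum_(k < n.+1) (n ^ 2 * 2 ^ (n - k) + n.+1 * 2 ^ n))).
    by rewrite big_mkcond; apply: leq_sum => k _; case: ifP.
  rewrite big_split /= -big_distrr sum_nat_const card_ord /=.
  have s := leq_mul (leqnn (n ^ 2)) (ltnW (sum_pow2 n)).
  (* The constant 6 is this 4 plus 2 from the geometric sum. *)
  have n1 : n.+1 * n.+1 <= 4 * n ^ 2 by rewrite -mulnn; move: n0; clear; nia.
  have := leq_mul n1 (leqnn (2 ^ n)); move: s; rewrite [2 ^ n.+1]expnS.
  move: (\sum_i _) (2 ^ n) (n ^ 2) => a b c; clear; lia.
have p : 0 < n ^ 2 * 2 ^ n by rewrite muln_gt0 !expn_gt0 n0.
rewrite -(leq_pmul2r p); move: total; rewrite (expnS n 2).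
move: (n ^ 2) (2 ^ n) K => a b g; clear; lia.
Qed.

(** Markov's inequality: exchanging the sums over graphs and triples reduces it to the first moment
    in [triangle_graphs]. *)
Lemma many_triangles_count m :
  #|[set E in regular_graphs V d | n <= m * #|[set S : {set V} | triangle E S]|]| * n
  <= m * 2 ^ ((d + 3) * 3) * tot.
Proof.
rewrite -sum_nat_const.
apply: (@leq_trans (\sum_(E in regular_graphs V d) m * #|[set S : {set V} | triangle E S]|)).
  rewrite big_mkcond [X in _ <= X]big_mkcond /=; apply: leq_sum => E _.
  rewrite inE; by case: (E \in _) => //=; case: ifP.
rewrite -big_distrr -mulnA leq_mul2l /=; apply/orP; right.
apply: leq_trans (triangle_graphs d3 nd); apply: eq_leq.
under eq_bigr => E _ do rewrite -sum1dep_card.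
under [RHS]eq_bigr => S _ do rewrite -sum1dep_card.
rewrite (exchange_big_dep (fun S : {set V} => #|S| == 3)) /=; last by move=> E S _ /andP[].
apply: eq_bigr => S S3; apply: eq_bigl => E; by rewrite /triangle S3.
Qed.

End Bad.

(** [large_rank] finds a colour with few components, and [spanning_tree_forest] a tree with at least
    n minus that many edges of this colour; the number of components cancels. *)
Lemma good_tree (V : finType) (d r : nat) (E : {set {set V}}) (f : {ffun edge E -> 'I_r}) :
  3 <= d -> 2 <= r -> 16 <= #|V| -> E \in regular_graphs V d -> ~~ has_dense d E ->
  12 * dense_const d * r * #|[set S : {set V} | triangle E S]| < #|V| ->
  connected_graph E /\ exists T, spanning_tree E T /\ exists i,
    (2 * (d * dense_const d)).+1 * #|V| <= r * (2 * (d * dense_const d)) * colour_count f T i.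
Proof.
move=> d3 r2 n16 rE nd few.
have no_dense (S : {set V}) : 4 <= #|S| -> 2 * #|S| <= #|V| -> ~~ dense d E S.
  by move=> S4 S2; apply: contra nd => dS; apply/existsP; exists S; rewrite S4 S2.
have cE : connected_graph E.
  by apply: connected_of_no_dense d3 rE no_dense _; apply: leq_trans n16.
split=> //.
pose H (i : 'I_r) : {set {set V}} := [set val e | e in [set e : edge E | f e == i]].
have HE i : H i \subset E by apply/subsetP => _ /imsetP[e _ ->]; apply: valP.
have Hc e : e \in E -> exists i, e \in H i.
  move=> eE; exists (f (exist _ e eE)); apply/imsetP; exists (exist _ e eE) => //.
  by rewrite inE.
have [i hi] := large_rank d3 rE no_dense r2 HE Hc n16 few.
have [T [sT hT]] := spanning_tree_forest (regular_simple rE) cE (HE i).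
exists T; split=> //; exists i.
have le : #|T :&: H i| <= colour_count f T i.
  rewrite /colour_count -[X in _ <= X](card_imset _ val_inj); apply: subset_leq_card.
  apply/subsetP => e; rewrite inE => /andP[eT /imsetP[x]]; rewrite inE => fx ex.
  by apply/imsetP; exists x => //; rewrite inE fx -ex.
have h : #|V| <= colour_count f T i + #|components (H i)|.
  by apply: leq_trans hT _; rewrite leq_add2r.
have := leq_mul (leqnn (r * (2 * (d * dense_const d)))) h.
rewrite mulnDr => h'; have := leq_trans hi h'; by rewrite leq_add2r.
Qed.

Lemma dense_const_gt0 d : 0 < d -> 0 < dense_const d.
Proof. by move=> d0; apply: leq_trans (dense_const_ge d0). Qed.

Lemma card_edges_le (V : finType) d (E : {set {set V}}) : E \in regular_graphs V d ->
  #|E| <= d * #|V|.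
Proof.
move=> rE; rewrite -[#|V|]cardsT -(card_arcs_cut setT rE).
apply: leq_trans (leq_addr _ _).
apply: leq_trans (leq_imset_card (fun a : V * V => [set a.1; a.2]) _).
apply: subset_leq_card; apply/subsetP => e eE.
have /cards2P[u [v [uv eE']]] := forall_inP (regular_simple rE) _ eE; subst e.
by apply/imsetP; exists (u, v); rewrite // !inE.
Qed.

Lemma colour_count_le (V : finType) d (E T : {set {set V}}) r (f : {ffun edge E -> 'I_r}) i :
  E \in regular_graphs V d -> colour_count f T i <= d * #|V|.
Proof.
move=> rE; apply: leq_trans (card_edges_le rE).
by apply: leq_trans (max_card _) _; rewrite card_sig.
Qed.

Definition bad_const d r := 6 * (d.+1 * (large_const d + 2 ^ (5 * d + 36)))
  + 12 * dense_const d * r * 2 ^ ((d + 3) * 3).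

Definition good (V : finType) d r (E : {set {set V}}) :=
  ~~ has_dense d E && (12 * dense_const d * r * #|[set S : {set V} | triangle E S]| < #|V|).

Lemma bad_count (V : finType) d r : 3 <= d -> 8 * d <= #|V| ->
  #|[set E in regular_graphs V d | ~~ good d r E]| * #|V| <= bad_const d r * #|regular_graphs V d|.
Proof.
move=> d3 nd; set m := 12 * dense_const d * r.
apply: (@leq_trans ((#|[set E in regular_graphs V d | has_dense d E]| +
  #|[set E in regular_graphs V d | #|V| <= m * #|[set S : {set V} | triangle E S]|]|) * #|V|)).
  rewrite leq_mul2r; apply/orP; right; apply: leq_trans (leq_card_setU _ _).
  apply: subset_leq_card; apply/subsetP => E; rewrite !inE negb_and negbK -leqNgt.
  by case/andP=> -> /= ->.
rewrite mulnDl /bad_const mulnDl leq_add ?has_dense_count //.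
exact: many_triangles_count.
Qed.

(* Real-valued discrepancy and the limit *)
From mathcomp Require Import all_classical all_reals all_analysis.
Import Order.TTheory GRing.Theory Num.Theory.
Import numFieldNormedType.Exports.
Local Open Scope classical_set_scope.
Local Open Scope ring_scope.

Lemma tree_discrepancyE (R : realType) (V : finType) (E T : {set {set V}}) r
    (f : {ffun edge E -> 'I_r}) : (0 < r)%N ->
  tree_discrepancy R f T = r%:R * (\max_(i < r) colour_count f T i)%N%:R - #|V|%:R + 1.
Proof.
move=> r0; rewrite /tree_discrepancy mulrBr mulrCA divff ?mulr1 ?opprB ?addrA //.
  by rewrite addrAC.
by rewrite pnatr_eq0 -lt0n.
Qed.

(** By [good_tree] every colouring has a tree with r times its largest colour count at least (1 +
    1/M) n, so subtracting n - 1 leaves more than n/M. The upper bound counts all edges, at most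
    dn. *)
Lemma good_discrepancy (R : realType) (V : finType) d r (E : {set {set V}}) :
  (3 <= d)%N -> (2 <= r)%N -> (16 <= #|V|)%N -> E \in regular_graphs V d -> good d r E ->
  connected_graph E /\
  ((2 * (d * dense_const d))%N%:R)^-1 * #|V|%:R <= discrepancy R E r <= (r * d)%N%:R * #|V|%:R.
Proof.
move=> d3 r2 n16 rE /andP[nd few].
have r0 : (0 < r)%N by apply: leq_trans r2.
pose f0 : {ffun edge E -> 'I_r} := [ffun=> Ordinal r0].
split; first by case: (good_tree f0 d3 r2 n16 rE nd few).
set M := (2 * (d * dense_const d))%N.
have d0 : (0 < d)%N by apply: leq_trans d3.
have M0 : (0 < M)%N by rewrite /M muln_gt0 muln_gt0 d0 dense_const_gt0.
have upper (f : {ffun edge E -> 'I_r}) T : tree_discrepancy R f T <= (r * d)%N%:R * #|V|%:R.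
  rewrite tree_discrepancyE // -addrA.
  apply: (@le_trans _ _ (r%:R * (\max_(i < r) colour_count f T i)%N%:R)).
    rewrite gerDl addrC subr_le0 (ler_nat R 1); exact: leq_trans n16.
  rewrite -!natrM ler_nat -mulnA leq_mul2l; apply/orP; right.
  by apply/bigmax_leqP => i _; apply: colour_count_le.
(* [sup] is the intended maximum only for a nonempty set bounded above; this bound and the tree from
   [lower] provide both. *)
have ub (f : {ffun edge E -> 'I_r}) :
    ubound [set tree_discrepancy R f T | T in spanning_tree E] ((r * d)%N%:R * #|V|%:R).
  by move=> _ [T _ <-]; apply: upper.
have lower (f : {ffun edge E -> 'I_r}) :
    exists2 T, spanning_tree E T & M%:R^-1 * #|V|%:R <= tree_discrepancy R f T.
  have [_ [T [sT [i hi]]]] := good_tree f d3 r2 n16 rE nd few.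
  exists T => //; rewrite tree_discrepancyE // -addrA.
  have MR : (0 : R) < M%:R by rewrite ltr0n.
  rewrite -(ler_pM2l MR) mulVKf ?gt_eqF // mulrDr -natrM -natrM.
  have hmax : (M.+1 * #|V| <= M * (r * \max_(i < r) colour_count f T i))%N.
    apply: leq_trans hi _; rewrite -/M mulnA [(M * r)%N]mulnC.
    by rewrite leq_mul2l; apply/orP; right; apply: leq_bigmax.
  apply: (@le_trans _ _ ((M.+1 * #|V|)%N%:R + M%:R * (- #|V|%:R + 1))); last first.
    by rewrite lerD2r ler_nat.
  rewrite mulrDr mulr1 mulrN -natrM mulSn natrD addrA addrK lerDl ler0n //.
have lb_sup (f : {ffun edge E -> 'I_r}) :
    M%:R^-1 * #|V|%:R <= sup [set tree_discrepancy R f T | T in spanning_tree E].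
  have [T sT hT] := lower f; apply: le_trans hT _.
  by apply: ub_le_sup; [exists ((r * d)%N%:R * #|V|%:R); apply: ub | exists T].
apply/andP; split.
  apply: lb_le_inf; first by exists (sup [set tree_discrepancy R f0 T | T in spanning_tree E]), f0.
  by move=> _ [f _ <-].
apply: (@le_trans _ _ (sup [set tree_discrepancy R f0 T | T in spanning_tree E])).
  apply: ge_inf; last by exists f0.
  by exists (M%:R^-1 * #|V|%:R) => _ [f _ <-].
apply: ge_sup (ub f0); have [T sT _] := lower f0.
by exists (tree_discrepancy R f0 T), T.
Qed.

Theorem corollary1p5 (R : realType) (r d : nat) (hr : (2 <= r)%N)
    (hd : (3 <= d)%N) :
  exists c1 c2 : R, [/\ 0 < c1, 0 < c2 &
    (fun n : nat => uniform_probability R (regular_graphs 'I_n d)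
       (fun G => connected_graph G /\
          c1 * n%:R <= discrepancy R G r <= c2 * n%:R))
      @ within [set n : nat | ~~ odd (d * n)] \oo --> (1 : R)].
Proof.
have d0 : (0 < d)%N by apply: leq_trans hd.
exists ((2 * (d * dense_const d))%N%:R)^-1, (r * d)%N%:R; split.
- by rewrite invr_gt0 ltr0n muln_gt0 muln_gt0 d0 dense_const_gt0.
- by rewrite ltr0n muln_gt0 d0 andbT (leq_trans _ hr).
apply/cvgrPdist_le => e e0; rewrite near_withinE.
near=> n => /= ev.
have nd : (8 * d <= n)%N by near: n; apply: nbhs_infty_ge.
have n16 : (16 <= n)%N by near: n; apply: nbhs_infty_ge.
(* The failure probability is at most [bad_const d r] over n, hence at most [e] from here on. *)
have nK : (bad_const d r)%:R / e <= n%:R :> R by near: n; apply: nbhs_infty_ger.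
have n0 : (0 < n)%N by apply: leq_trans n16.
have nR : (0 : R) < n%:R by rewrite ltr0n.
have tot0 : (0 < #|regular_graphs 'I_n d|)%N.
  by apply: regular_graphs_gt0 ev; apply: leq_trans nd; move: hd; clear; lia.
set tot := #|_| in tot0.
rewrite /uniform_probability; set a := #|_| => /=.
have totR : (0 : R) < tot%:R by rewrite ltr0n.
have a_le : (a <= tot)%N.
  by apply: subset_leq_card; apply/fintype.subsetP => E; rewrite inE => /andP[].
have := @bad_count 'I_n d r hd; rewrite card_ord => /(_ nd); rewrite -/tot.
set b := #|_| => bad.
(* Each regular graph satisfies the event or fails [good], so the upper bound on [b] is a lower
   bound on [a]. *)
have ab : (tot <= a + b)%N.
  apply: leq_trans (leq_card_setU _ _); apply: subset_leq_card.
  apply/fintype.subsetP => E rE; apply/finset.setUP.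
  have [g|ng] := boolP (good d r E); [left|right]; rewrite finset.in_set rE //=.
  apply/asboolP; rewrite -[in n%:R](card_ord n).
  by apply: good_discrepancy => //; rewrite card_ord.
have -> : 1 - a%:R / tot%:R = (tot%:R - a%:R) / tot%:R :> R.
  by rewrite mulrBl divff ?gt_eqF.
rewrite ger0_norm; last by rewrite divr_ge0 ?ler0n // subr_ge0 ler_nat.
rewrite ler_pdivrMr // lerBlDl.
apply: (@le_trans _ _ (a%:R + b%:R)); first by rewrite -natrD ler_nat.
rewrite lerD2l -(ler_pM2r nR).
apply: (@le_trans _ _ ((bad_const d r)%:R * tot%:R)); first by rewrite -!natrM ler_nat.
rewrite mulrAC ler_pM2r //.
by move: nK; rewrite ler_pdivrMr // mulrC.
Unshelve. all: by end_near.
Qed.
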